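(* Let $\Gamma$ be a finite simplicial graph and let $A_\Gamma$ be its right-angled Artin group. Then $\operatorname{Div}^0(A_\Gamma)$ exists if and only if $\Gamma$ is connected. In this case, $\operatorname{Div}^0(A_\Gamma)\asymp r$ if and only if $A_\Gamma$ is a nontrivial direct product (a direct product of two nontrivial groups), and $\operatorname{Div}^0(A_\Gamma)\asymp r^2$ otherwise.
   Context: Right-angled Artin groups: $\Gamma$ is a finite graph with no loops or multiple edges, with vertices $a_1,\dots,a_n$, and $A_\Gamma=\langle a_1,\dots,a_n\mid [a_i,a_j]=1 \text{ whenever } a_i,a_j \text{ are joined by an edge of }\Gamma\rangle$. The flag complex $L$ of $\Gamma$ has the same vertex set, with a set of vertices spanning a simplex iff they are pairwise joined by edges. In the torus $(S^1)^n$ (each $S^1$ with one $0$-cell and one $1$-cell, the $i$-th factor corresponding to $a_i$), take the subcomplex consisting of those cells whose set of $S^1$-factors corresponds to a simplex of $L$ (together with the vertex); $X_\Gamma$ is its universal cover, a CAT(0) cube complex on which $A_\Gamma$ acts geometrically. Its vertices are identified with elements of $A_\Gamma$, with basepoint the identity $e$. Balls and spheres in $X=X_\Gamma$ are taken with respect to the length metric restricting to the $\ell^1$ metric on each cube; $S_r$ is the sphere of radius $r$ about $e$. Divergence of geodesics: a point, chain or path is $r$-avoidant if it is disjoint from the open ball of radius $r$ about $e$. For $0<\rho\le 1$, $X$ is $(\rho,0)$-acyclic at infinity if every $r$-avoidant $0$-cycle ($0$-chain with coefficient sum zero) is the boundary of a $\rho r$-avoidant $1$-chain. $\operatorname{Div}^0(A_\Gamma)$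 exists (is defined) if $X$ is $(\rho,0)$-acyclic at infinity for some $0<\rho\le1$; let $\bar\rho$ be the supremum of such $\rho$. Then $\operatorname{div}^0_\rho(r)=\sup_{x,y\in S_r}\inf_P|P|$, with the infimum of lengths over $\rho r$-avoidant paths $P$ from $x$ to $y$, and $\operatorname{Div}^0(A_\Gamma)$ is the equivalence class of the family $\{\operatorname{div}^0_\rho(r)\}$, $0<\rho\le\bar\rho$. Comparison of families: $\{f_\rho\}\preceq\{f'_\rho\}$ if there exist $\rho_0>0$ and $L>1$ such that for all $0<\rho\le\rho_0$ there is a constant $A>1$ with $f_\rho(x)\le A f'_{L\rho}(Ax+A)+O(1)$ for all $x>0$; $\asymp$ means $\preceq$ in both directions. A single function $h(r)$ is regarded as the constant family equal to $h(r)$ for every $\rho$.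
   Formalization: The graph is assumed to have at least two vertices; the claim is false for one vertex (the group is Z, the graph is connected, but Div^0 does not exist) and for the empty graph (Div^0 is neither linear nor quadratic). *)

(* Defs.v *)
From HB Require Import structures.
From mathcomp Require Import all_boot all_order all_algebra generic_quotient.
From mathcomp Require Import all_classical all_reals all_analysis.
From mathcomp Require Import homotopy.
From mathcomp Require Import freeg.

Set Implicit Arguments.
Unset Strict Implicit.
Unset Printing Implicit Defensive.
Import Order.TTheory GRing.Theory Num.Theory.
Import numFieldNormedType.Exports.
Local Open Scope classical_set_scope.
Local Open Scope ring_scope.

(** * Groups given by generators and relators *)

(* The letter (a, true) is the generator a, the letter (a, false) its inverse. *)
Definition word (V : Type) := seq (V * bool).

Definition inv_word (V : Type) (w : word V) : word V :=
  rev [seq (x.1, ~~ x.2) | x <- w].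

Inductive pres_eq (V : Type) (rels : set (word V)) : word V -> word V -> Prop :=
| PresRefl w : pres_eq rels w w
| PresSym v w : pres_eq rels v w -> pres_eq rels w v
| PresTrans u v w : pres_eq rels u v -> pres_eq rels v w -> pres_eq rels u w
| PresCat v v' w w' : pres_eq rels v v' -> pres_eq rels w w' ->
    pres_eq rels (v ++ w) (v' ++ w')
| PresCancel a b : pres_eq rels [:: (a, b); (a, ~~ b)] [::]
| PresRel w : rels w -> pres_eq rels w [::].

Section Presentation.
Context (V : choiceType) (rels : set (word V)).
Implicit Types v w : word V.

Definition pres_eqb v w : bool := `[< pres_eq rels v w >].

Lemma pres_eqb_equiv : equiv_class_of pres_eqb.
Proof.
split.
- by move=> w; apply/asboolP; exact: PresRefl.
- by move=> v w; apply/asboolP/asboolP; exact: PresSym.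
- move=> v u w /asboolP uv /asboolP vw; apply/asboolP.
  exact: PresTrans uv vw.
Qed.

Canonical pres_equiv := EquivRelPack pres_eqb_equiv.

(* The group < V | rels >. *)
Definition presented := {eq_quot pres_equiv}%qT.

HB.instance Definition _ := Choice.on presented.
HB.instance Definition _ := Quotient.on presented.

Definition pres_class w : presented := (\pi_presented w)%qT.

Lemma pres_classP v w : pres_class v = pres_class w <-> pres_eq rels v w.
Proof.
rewrite /pres_class; split => [/eqmodP/asboolP//|vw].
by apply/eqmodP/asboolP.
Qed.

Lemma pres_classK (x : presented) : pres_class (repr x) = x.
Proof. exact: reprK. Qed.

Lemma repr_pres_class w : pres_eq rels (repr (pres_class w)) w.
Proof. by apply/pres_classP; rewrite pres_classK. Qed.

Definition pres_one : presented := pres_class [::].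
Definition pres_mul (x y : presented) : presented :=
  pres_class (repr x ++ repr y).
Definition pres_inv (x : presented) : presented :=
  pres_class (inv_word (repr x)).

Lemma pres_class_cat v w :
  pres_mul (pres_class v) (pres_class w) = pres_class (v ++ w).
Proof. by apply/pres_classP; apply: PresCat; exact: repr_pres_class. Qed.

Lemma pres_mulA : associative pres_mul.
Proof.
move=> x y z; rewrite -(pres_classK x) -(pres_classK y) -(pres_classK z).
by rewrite !pres_class_cat catA.
Qed.

Lemma pres_mul1 : left_id pres_one pres_mul.
Proof. by move=> x; rewrite -(pres_classK x) pres_class_cat. Qed.

Lemma pres_mulr1 : right_id pres_one pres_mul.
Proof. by move=> x; rewrite -(pres_classK x) pres_class_cat cats0. Qed.

Lemma pres_eq_inv_r w : pres_eq rels (w ++ inv_word w) [::].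
Proof.
elim: w => [|[a b] w IHw]; first exact: PresRefl.
have -> : ((a, b) :: w) ++ inv_word ((a, b) :: w) =
    [:: (a, b)] ++ ((w ++ inv_word w) ++ [:: (a, ~~ b)]).
  by rewrite /inv_word /= rev_cons -cats1 /= catA.
apply: PresTrans (PresCancel rels a b).
rewrite -[X in pres_eq _ _ X]/([:: (a, b)] ++ ([::] ++ [:: (a, ~~ b)])).
apply: PresCat; first exact: PresRefl.
by apply: PresCat IHw _; exact: PresRefl.
Qed.

Lemma inv_wordK : involutive (@inv_word V).
Proof.
move=> w; rewrite /inv_word map_rev revK -map_comp map_id_in//.
by case=> a b _ /=; rewrite negbK.
Qed.

Lemma pres_mulV : left_inverse pres_one pres_inv pres_mul.
Proof.
move=> x; rewrite -[X in pres_mul _ X](pres_classK x) pres_class_cat.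
apply/pres_classP; rewrite -[X in _ ++ X]inv_wordK.
exact: pres_eq_inv_r.
Qed.

Lemma pres_mulrV : right_inverse pres_one pres_inv pres_mul.
Proof.
move=> x; rewrite -[X in pres_mul X _](pres_classK x) pres_class_cat.
by apply/pres_classP; exact: pres_eq_inv_r.
Qed.

HB.instance Definition _ := isGroup.Build presented
  pres_mulA pres_mul1 pres_mulr1 pres_mulV pres_mulrV.

Definition pres_gen (a : V) : presented := pres_class [:: (a, true)].

End Presentation.

Definition commutator_word (V : Type) (a b : V) : word V :=
  [:: (a, true); (b, true); (a, false); (b, false)].

Definition raag (V : finType) (e : rel V) : groupType :=
  presented [set w | exists a b, e a b /\ w = commutator_word a b].

Definition raag_gen (V : finType) (e : rel V) (a : V) : raag e := pres_gen _ a.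

Definition nontrivial_direct_product (A : groupType) : Prop :=
  exists G H : groupType,
    [/\ exists g : G, g <> 1%g, exists h : H, h <> 1%g &
        exists f : A -> G * H, {morph f : x y / (x * y)%g} /\ bijective f].

(** * The universal cover of the Salvetti complex *)

Definition clique (V : finType) (e : rel V) (S : {pred V}) : bool :=
  [forall a, forall b, [&& a \in S, b \in S & a != b] ==> e a b].

(* A point of the torus (R/Z)^V, with coordinates taken in [0, 1), lies in the
   open cell spanned by the factors in which its coordinate is nonzero. *)
Definition in_salvetti (R : realType) (V : finType) (e : rel V)
    (t : {ffun V -> R}) : bool :=
  [forall a, 0 <= t a < 1] && clique e [pred a | t a != 0].

(* The universal cover X, with vertex set A = raag e: the lifts of the cell of a
   clique S are the cubes (g, S), g : A, where g is the vertex of the cube at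
   which all coordinates vanish, and the vertex of (g, S) with coordinates
   1_{S'}, S' a subset of S, is g * \prod_(a in S') a.  Each point of X is in
   the interior of a unique cube; (g, t) is the point of coordinates t in the
   cube (g, [pred a | t a != 0]), and (g, t) |-> t is the covering map. *)
Record raag_cover (R : realType) (V : finType) (e : rel V) := RaagCover {
  cover_val : raag e * {ffun V -> R};
  _ : in_salvetti e cover_val.2 }.

HB.instance Definition _ (R : realType) (V : finType) (e : rel V) :=
  [isSub for @cover_val R V e].
HB.instance Definition _ (R : realType) (V : finType) (e : rel V) :=
  [Choice of raag_cover R e by <:].

Section CoverMetric.
Context (R : realType) (V : finType) (e : rel V).
Implicit Types (s t : {ffun V -> R}) (g : raag e) (x y z : raag_cover R e).

Definition cube_coord (S : {pred V}) t : Prop :=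
  (forall a, 0 <= t a <= 1) /\ (forall a, a \notin S -> t a = 0).

(* The point of coordinates t in a closed cube with 0-vertex g.  The order of
   the product is irrelevant, since the a with t a = 1 are in a clique. *)
Definition cube_chart g t : raag e * {ffun V -> R} :=
  ((g * \big[*%g/1%g]_(a | t a == 1%R) raag_gen e a)%g,
   [ffun a => if t a == 1 then 0 else t a]).

Definition l1_dist s t : R := \sum_a `|s a - t a|.

(* A string from x to z of length c: a finite sequence of points from x to z, any
   two consecutive ones lying in a common closed cube, c being the sum of the l^1
   distances between consecutive points. *)
Inductive cube_string : raag_cover R e -> raag_cover R e -> R -> Prop :=
| StringNil x : cube_string x x 0
| StringCons x y z g (S : {pred V}) s t c :
    clique e S -> cube_coord S s -> cube_coord S t ->
    cover_val x = cube_chart g s -> cover_val y = cube_chart g t ->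
    cube_string y z c ->
    cube_string x z (l1_dist s t + c).

(* The length metric that restricts to the l^1 metric on each cube. *)
Definition cover_dist x y : \bar R :=
  ereal_inf [set c%:E | c in cube_string x y].

Lemma l1_distC s t : l1_dist s t = l1_dist t s.
Proof. by apply: eq_bigr => a _; rewrite distrC. Qed.

Lemma cube_string_ge0 x y c : cube_string x y c -> 0 <= c.
Proof.
elim=> {x y c}[//|x y z g S s t c _ _ _ _ _ _ IH].
by rewrite addr_ge0// sumr_ge0.
Qed.

Lemma cube_string_cat x y z c d :
  cube_string x y c -> cube_string y z d -> cube_string x z (c + d).
Proof.
elim=> {x y c}[x|x y w g S s t c cS Ss St xs yt _ IH] zd; first by rewrite add0r.
by rewrite -addrA; apply: StringCons cS Ss St xs yt _; exact: IH.
Qed.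

Lemma cube_string_rev x y c : cube_string x y c -> cube_string y x c.
Proof.
elim=> {x y c}[x|x y w g S s t c cS Ss St xs yt _ IH]; first exact: StringNil.
rewrite addrC -[l1_dist s t]addr0; apply: cube_string_cat IH _.
by rewrite l1_distC; apply: StringCons cS St Ss yt xs _; exact: StringNil.
Qed.

Lemma cover_distxx x : cover_dist x x = 0%E.
Proof.
apply/eqP; rewrite eq_le; apply/andP; split.
  by apply: ereal_inf_lbound; exists 0 => //; exact: StringNil.
by apply: le_ereal_inf_tmp => _ [c /cube_string_ge0 c0 <-]; rewrite lee_fin.
Qed.

Lemma cover_dist_ltP x y (r : R) :
  (cover_dist x y < r%:E)%E <-> exists2 c, cube_string x y c & c < r.
Proof.
split=> [/ereal_inf_lt[_ [c xyc <-]]|[c xyc cr]].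
  by rewrite lte_fin; exists c.
apply: (@le_lt_trans _ _ c%:E); last by rewrite lte_fin.
by apply: ereal_inf_lbound; exists c.
Qed.

Definition cover_ball x (r : R) : set (raag_cover R e) :=
  [set y | (cover_dist x y < r%:E)%E].

Lemma cover_ball_center x (r : R) : 0 < r -> cover_ball x r x.
Proof. by move=> r0; rewrite /cover_ball/= cover_distxx lte_fin. Qed.

Lemma cover_ball_sym x y (r : R) : cover_ball x r y -> cover_ball y r x.
Proof.
move=> /cover_dist_ltP[c xyc cr]; apply/cover_dist_ltP.
by exists c => //; exact: cube_string_rev.
Qed.

Lemma cover_ball_triangle x y z (r1 r2 : R) :
  cover_ball x r1 y -> cover_ball y r2 z -> cover_ball x (r1 + r2) z.
Proof.
move=> /cover_dist_ltP[c xyc cr] /cover_dist_ltP[d yzd dr].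
apply/cover_dist_ltP; exists (c + d); last exact: ltrD.
exact: cube_string_cat xyc yzd.
Qed.

HB.instance Definition _ := hasNbhs.Build (raag_cover R e)
  (nbhs_ (entourage_ cover_ball)).

HB.instance Definition _ := @Nbhs_isPseudoMetric.Build R (raag_cover R e)
  (entourage_ cover_ball) erefl cover_ball
  cover_ball_center cover_ball_sym cover_ball_triangle erefl.

Lemma cover_base_subproof : in_salvetti e ([ffun=> 0] : {ffun V -> R}).
Proof.
apply/andP; split; first by apply/forallP => a; rewrite ffunE lexx ltr01.
apply/forallP => a; apply/forallP => b; apply/implyP => /and3P[].
by rewrite inE ffunE eqxx.
Qed.

Definition cover_base : raag_cover R e :=
  @RaagCover R V e (1%g, [ffun=> 0]) cover_base_subproof.

End CoverMetric.

(** * Paths and singular chains *)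

Definition unit_itv (R : realType) : Type := set_type (`[0, 1]%classic : set R).

HB.instance Definition _ (R : realType) := Topological.on (unit_itv R).

Section UnitInterval.
Context (R : realType).

Lemma unit_itv0 : (0 : R) \in (`[0, 1]%classic : set R).
Proof. by apply/mem_set; rewrite /= in_itv/= lexx ler01. Qed.

Lemma unit_itv1 : (1 : R) \in (`[0, 1]%classic : set R).
Proof. by apply/mem_set; rewrite /= in_itv/= lexx ler01. Qed.

Lemma unit_itv01 : (SigSub unit_itv0 : unit_itv R) != SigSub unit_itv1.
Proof. by apply/eqP => /(congr1 val)/eqP; rewrite /= eq_sym oner_eq0. Qed.

HB.instance Definition _ := isBiPointed.Build (unit_itv R) unit_itv01.

End UnitInterval.

Section Divergence.
Context (R : realType) (V : finType) (e : rel V).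
Local Notation X := (raag_cover R e).
Local Notation I := (unit_itv R).

Definition avoidant (r : R) (x : X) : Prop :=
  (r%:E <= cover_dist (cover_base R e) x)%E.

Definition sphere (r : R) : set X :=
  [set x | cover_dist (cover_base R e) x = r%:E].

(* The supremum is over all subdivisions of [0, 1]. *)
Definition path_length (f : I -> X) : \bar R :=
  ereal_sup [set (\sum_(p <- zip u (behead u)) cover_dist (f p.1) (f p.2))%E |
    u in [set u : seq I | sorted (fun a b => val a <= val b) u]].

Definition simplex_boundary (f : continuousType I X) : {freeg X / int} :=
  << f one >> - << f zero >>.

Definition chain_boundary (c : {freeg (continuousType I X) / int}) :
    {freeg X / int} :=
  fglift simplex_boundary c.

Definition avoidant_chain0 (r : R) (z : {freeg X / int}) : Prop :=
  forall x, x \in dom z -> avoidant r x.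

Definition avoidant_chain1 (r : R) (c : {freeg (continuousType I X) / int}) :
    Prop :=
  forall f, f \in dom c -> forall t : I, avoidant r (f t).

(* [deg z] is the sum of the coefficients of z. *)
Definition acyclic_at_infinity0 (rho : R) : Prop :=
  forall (r : R) (z : {freeg X / int}), 0 < r -> deg z = 0 ->
    avoidant_chain0 r z ->
    exists2 c, avoidant_chain1 (rho * r) c & chain_boundary c = z.

Definition acyclic_parameters : set R :=
  [set rho | 0 < rho <= 1 /\ acyclic_at_infinity0 rho].

Definition Div0_exists : Prop := acyclic_parameters !=set0.

Definition rho_bar : R := sup acyclic_parameters.

(* +oo when no avoidant path exists, or none is rectifiable. *)
Definition avoidant_dist (r : R) (x y : X) : \bar R :=
  ereal_inf [set l | exists P : {path I from x to y},
    (forall t : I, avoidant r (P t)) /\ l = path_length P].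

Definition div0 (rho r : R) : \bar R :=
  ereal_sup [set d | exists x y : X, [/\ sphere r x, sphere r y &
    d = avoidant_dist (rho * r) x y]].

End Divergence.

(** * Comparison of families of functions *)

(* [family_fun f rho] is meaningful only for rho in [family_dom f]. *)
Record family (R : realType) := Family {
  family_dom : set R;
  family_fun : R -> R -> \bar R }.

Definition family_le (R : realType) (f f' : family R) : Prop :=
  exists rho0 L : R, [/\ 0 < rho0, 1 < L &
    forall rho, 0 < rho <= rho0 ->
      [/\ family_dom f rho, family_dom f' (L * rho) &
      exists A C : R, 1 < A /\ forall x, 0 < x ->
        (family_fun f rho x <=
           A%:E * family_fun f' (L * rho) (A * x + A)%R + C%:E)%E]].

Definition family_asymp (R : realType) (f f' : family R) : Prop :=
  family_le f f' /\ family_le f' f.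

Definition constant_family (R : realType) (h : R -> R) : family R :=
  Family [set: R] (fun _ r => (h r)%:E).

Definition Div0 (R : realType) (V : finType) (e : rel V) : family R :=
  Family [set rho | 0 < rho <= rho_bar R e] (div0 e).

(* Main.v *)
(* Let |g| be the word length on A.  The distance from e is affine on every cube of
   X, so avoidance of balls can be read off at vertices.

   Upper bounds.  To join a vertex g of length n to a fixed far point outside the
   ball of radius n, first go straight out to g b^N with N = 2n.  If Gamma is
   connected, walk back along the prefixes h of a word for g, staying at points
   h c^N: before crossing a letter a, exchange c for a through the flats spanned by
   adjacent vertices.  Every point on the way is at distance at least N - n, and the
   cost is O(n) per letter.  If Gamma is a join, every vertex of one side commutes
   with every vertex of the other and a bounded number of exchanges is enough.  If
   Gamma is disconnected, e is a cut point of X.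

   Lower bound.  If the complement of Gamma is connected, a closed walk in it through
   all vertices spells a positive word w no two cyclically consecutive letters of
   which commute.  If p does not begin with the first letter of w but q begins with
   w, then p and q have no common initial letter, since it would have to commute with
   all of w, hence d(p, q) = |p| + |q|.  Along a path that avoids the ball of radius
   rho n and joins points whose common prefixes with w w w ... have lengths 0 and n,
   every bounded increase of this length, while it is below rho n / 2, thus costs at
   least a multiple of rho n.

   The same rigidity shows that an element commuting with w is determined by its
   exponent sum; in G x H, the centralizer of w = (w1, w2) contains C(w1) x C(w2), so
   A is not a nontrivial product when the complement of Gamma is connected. *)

Require Import Defs.
From mathcomp Require Import all_boot all_order all_algebra.
From mathcomp Require Import all_classical all_reals all_analysis.
From mathcomp Require Import homotopy freeg.
From mathcomp Require Import zify ring lra.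
Import Order.TTheory GRing.Theory Num.Theory numFieldNormedType.Exports.

Set Implicit Arguments.
Unset Strict Implicit.
Unset Printing Implicit Defensive.

(** * Normal forms in right-angled Artin groups *)

Section Words.
Context (V : finType) (e : rel V).
Hypotheses (e_sym : symmetric e) (e_irr : irreflexive e).
Implicit Types (a b c : V) (s t : V * bool) (u v w z : word V).

Definition linv s : V * bool := (s.1, ~~ s.2).

Lemma linvK : involutive linv.
Proof. by case=> a b; rewrite /linv /= negbK. Qed.

Lemma linv_neq s : linv s != s.
Proof. by case: s => a [|]; rewrite /linv xpair_eqE eqxx. Qed.

Definition proj a b : word V -> word V := seq.filter (fun s => (s.1 == a) || (s.1 == b)).

(** Some [s] in [w] can be slid to the front past commuting letters. The case [b = s.1], present
    since [e] is irreflexive, forces [s] to occur. *)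
Definition initial s w : bool :=
  [forall b, ~~ e s.1 b ==> (ohead (proj s.1 b w) == Some s)].

(* A reduced word is determined, up to exchanging adjacent commuting letters, by its
   projections to the pairs of non-commuting generators. *)
Definition shuffle u v : Prop := forall a b, ~~ e a b -> proj a b u = proj a b v.

Lemma initialP s w : reflect (forall b, ~~ e s.1 b -> ohead (proj s.1 b w) = Some s)
  (initial s w).
Proof.
apply: (iffP forallP) => [H b eb|H b]; first by move: (H b); rewrite eb => /eqP.
by apply/implyP => eb; rewrite H.
Qed.

Lemma shuffle_refl w : shuffle w w. Proof. by []. Qed.

Lemma shuffle_sym u v : shuffle u v -> shuffle v u.
Proof. by move=> H a b ab; rewrite H. Qed.

Lemma shuffle_trans u v w : shuffle u v -> shuffle v w -> shuffle u w.
Proof. by move=> H K a b ab; rewrite H // K. Qed.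

Lemma shuffle_initial u v s : shuffle u v -> initial s u = initial s v.
Proof. by move=> H; apply/initialP/initialP => K b eb; rewrite -?H ?K // H ?K. Qed.

Lemma shuffle_cons s u v : shuffle u v -> shuffle (s :: u) (s :: v).
Proof. by move=> H a b ab; rewrite /proj /= -/(proj a b) H. Qed.

Lemma shuffle_swap s t w : e s.1 t.1 -> shuffle (s :: t :: w) (t :: s :: w).
Proof.
move=> est a b ab; rewrite /proj /=.
case: ifPn; case: ifPn => // /orP ht /orP hs.
exfalso; move/negP: ab; apply.
have nst : s.1 != t.1 by apply/eqP => E; move: est; rewrite E e_irr.
case: hs ht => /eqP hs [] /eqP ht; move: est nst; rewrite hs ht ?eqxx //.
by rewrite e_sym.
Qed.

Lemma filter_rem (T : eqType) (p : pred T) (x : T) (w : seq T) :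
  seq.filter p (rem x w) = if p x then rem x (seq.filter p w) else seq.filter p w.
Proof.
elim: w => [|y w IH] /=; first by case: ifP.
case: (eqVneq y x) => [->|nyx] /=; first by case: (p x) => //=; rewrite eqxx.
rewrite IH; case: (p y); case: (p x) => //=.
by rewrite (negbTE nyx).
Qed.

Lemma remC (T : eqType) (x y : T) (w : seq T) : rem x (rem y w) = rem y (rem x w).
Proof.
elim: w => [|z w IH] //=.
case: (eqVneq z y) => [Ey|zy]; case: (eqVneq z x) => [Ex|zx] /=.
- by rewrite -Ex Ey.
- by rewrite Ey eqxx.
- by rewrite Ex eqxx.
- by rewrite (negbTE zy) (negbTE zx) IH.
Qed.

Lemma shuffle_rem s u v : shuffle u v -> shuffle (rem s u) (rem s v).
Proof. by move=> H a b ab; rewrite /proj !filter_rem -/(proj a b) (H _ _ ab). Qed.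

Lemma rem_head (T : eqType) (x : T) (w : seq T) : ohead w = Some x -> x :: rem x w = w.
Proof. by case: w => //= y w [->]; rewrite eqxx. Qed.

Lemma initial_rem_shuffle s w : initial s w -> shuffle (s :: rem s w) w.
Proof.
move=> /initialP H a b ab; rewrite /proj /= filter_rem.
case h: ((s.1 == a) || (s.1 == b)) => //; apply: rem_head; case/orP: h => /eqP E.
  by rewrite -E; apply: H; rewrite E.
rewrite -(H a); last by rewrite e_sym -E in ab.
by congr (@ohead _ _); apply: eq_filter => x; rewrite orbC E.
Qed.

Lemma initial_cons s t w :
  initial s (t :: w) = (s == t) || (e s.1 t.1 && initial s w).
Proof.
case: (eqVneq s t) => [->|st] /=.
  by apply/initialP => b _; rewrite /proj /= eqxx.
apply/initialP/andP => [H|[est /initialP H] b eb].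
  have est : e s.1 t.1.
    apply/negPn/negP => nst; move: (H _ nst).
    by rewrite /proj /= eqxx orbT => -[E]; rewrite E eqxx in st.
  split=> //; apply/initialP => b eb; move: (H b eb); rewrite /proj /= ifN //.
  rewrite negb_or; apply/andP; split; apply/eqP => E.
    by rewrite E e_irr in est.
  by rewrite -E est in eb.
rewrite /proj /= ifN ?H // negb_or; apply/andP; split; apply/eqP => E.
  by rewrite E e_irr in est.
by rewrite -E est in eb.
Qed.

Lemma initial_nil s : initial s [::] = false.
Proof. by apply/negP => /initialP /(_ s.1); rewrite e_irr => /(_ isT). Qed.

Lemma initial_adj s t w : initial s w -> initial t w -> s != t -> e s.1 t.1.
Proof.
move=> /initialP H /initialP K st; apply/negPn/negP => nst.
have := K s.1; rewrite e_sym nst => /(_ isT).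
suff -> : proj t.1 s.1 w = proj s.1 t.1 w by rewrite H // => -[E]; rewrite E eqxx in st.
by apply: eq_filter => x; rewrite orbC.
Qed.

Lemma initial_rem_adj s t w : e s.1 t.1 -> initial s (rem t w) = initial s w.
Proof.
move=> est.
have P b : ~~ e s.1 b -> proj s.1 b (rem t w) = proj s.1 b w.
  move=> eb; rewrite /proj filter_rem ifN // negb_or; apply/andP; split; apply/eqP => E.
    by rewrite E e_irr in est.
  by rewrite -E est in eb.
by apply/initialP/initialP => H b eb; move: (H b eb); rewrite P.
Qed.

Lemma initial_mem s w : initial s w -> s \in w.
Proof.
move=> /initialP /(_ s.1); rewrite e_irr => /(_ isT) H.
suff : s \in proj s.1 s.1 w by rewrite mem_filter => /andP[].
by case: (proj _ _ _) H => //= t u [->]; rewrite inE eqxx.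
Qed.

Lemma initial_head s w : initial s (s :: w).
Proof. by rewrite initial_cons eqxx. Qed.

Fixpoint reduced w : bool :=
  if w is s :: v then ~~ initial (linv s) v && reduced v else true.

Definition lmul s w : word V := if initial (linv s) w then rem (linv s) w else s :: w.

(** The second claim ensures that [s], put back after its removal, does not cancel; [lmulK] rests on
    it. *)
Lemma reduced_rem s w : reduced w -> initial s w ->
  reduced (rem s w) /\ ~~ initial (linv s) (rem s w).
Proof.
elim: w => [|t w IH] /=; first by rewrite initial_nil.
move=> /andP[nt rw]; rewrite initial_cons; case: (eqVneq s t) => [->//|ts].
move=> /andP[est is_]; have [r1 r2] := IH rw is_; split=> /=.
  by rewrite r1 initial_rem_adj ?nt // e_sym.
rewrite initial_cons negb_or (negbTE r2) andbF andbT.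
by apply/eqP => E; move: est; rewrite -E /= e_irr.
Qed.

Lemma reduced_lmul s w : reduced w -> reduced (lmul s w).
Proof.
rewrite /lmul; case: ifPn => [i r|i r] /=; first by case: (reduced_rem r i).
by rewrite i r.
Qed.

Lemma shuffle_lmul s u v : shuffle u v -> shuffle (lmul s u) (lmul s v).
Proof.
move=> H; rewrite /lmul (shuffle_initial _ H); case: ifP => _.
  exact: shuffle_rem.
exact: shuffle_cons.
Qed.

Lemma lmulK s w : reduced w -> shuffle (lmul s (lmul (linv s) w)) w.
Proof.
move=> rw; rewrite {2}/lmul linvK; case: ifPn => [i|i].
  have [_ r2] := reduced_rem rw i.
  by rewrite /lmul (negbTE r2); apply: initial_rem_shuffle.
by rewrite /lmul initial_head /= eqxx; apply: shuffle_refl.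
Qed.

Lemma lmulC s t w : e s.1 t.1 -> shuffle (lmul s (lmul t w)) (lmul t (lmul s w)).
Proof.
move=> est; have ets : e t.1 s.1 by rewrite e_sym.
have n1 : s.1 != t.1 by apply/eqP => E; rewrite E e_irr in est.
have nst : t != linv s by apply: contraNneq n1 => ->.
have nts : s != linv t by apply: contraNneq n1 => ->.
have A x y z : e x.1 y.1 -> initial (linv x) (lmul y z) = initial (linv x) z.
  move=> exy; rewrite /lmul; case: ifP => _; first by rewrite initial_rem_adj.
  rewrite initial_cons /= exy /=; case: eqP => //= E.
  by move: exy; rewrite -E /= e_irr.
rewrite {1}/lmul (A s t) // {3}/lmul (A t s) //.
rewrite /lmul; case: (initial (linv s) w); case: (initial (linv t) w) => /=.
- by rewrite remC; apply: shuffle_refl.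
- by rewrite (negbTE nst); apply: shuffle_refl.
- by rewrite (negbTE nts); apply: shuffle_refl.
- exact: shuffle_swap.
Qed.

Definition nf w : word V := foldr lmul [::] w.

Definition raag_rels : set (word V) :=
  [set w | exists a b, e a b /\ w = commutator_word a b]%classic.

Local Notation peq := (pres_eq raag_rels).

Lemma reduced_foldr u z : reduced z -> reduced (foldr lmul z u).
Proof. by move=> rz; elim: u => //= s u IH; apply: reduced_lmul. Qed.

Lemma reduced_nf w : reduced (nf w).
Proof. exact: reduced_foldr. Qed.

Lemma shuffle_foldr u v w : shuffle v w -> shuffle (foldr lmul v u) (foldr lmul w u).
Proof. by move=> H; elim: u => //= s u IH; apply: shuffle_lmul. Qed.

(** Van der Waerden's argument: letters act on reduced words modulo [shuffle] through [lmul], and by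
    [lmulK] and [lmulC] the relators act trivially. *)
Lemma foldr_peq u v : peq u v ->
  forall z, reduced z -> shuffle (foldr lmul z u) (foldr lmul z v).
Proof.
elim=> {u v}[w|v w _ IH|u v w _ IH1 _ IH2|v v' w w' _ IH1 _ IH2|a b|w [a [b [eab ->]]]] z rz.
- exact: shuffle_refl.
- by apply: shuffle_sym; apply: IH.
- by apply: shuffle_trans (IH1 _ rz) _; apply: IH2.
- rewrite !foldr_cat.
  apply: shuffle_trans (shuffle_foldr _ (IH2 _ rz)) _.
  by apply: IH1; apply: reduced_foldr.
- exact: (@lmulK (a, b)).
- rewrite /=.
  (* The two middle letters of the commutator are exchanged, after which both pairs cancel. *)
  have H := @lmulC (b, true) (a, false) (lmul (b, false) z).
  apply: shuffle_trans (shuffle_lmul _ (H _)) _; first by rewrite /= e_sym.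
  apply: shuffle_trans (@lmulK (a, true) _ _) _; first by do 2 apply: reduced_lmul.
  exact: (@lmulK (b, true)).
Qed.

Lemma nf_peq u v : peq u v -> shuffle (nf u) (nf v).
Proof. by move=> H; apply: foldr_peq. Qed.

(** * Word length and initial letters of group elements *)

Local Notation A := (raag e).

Definition cls w : A := pres_class _ w.

Lemma cls_eqP u v : cls u = cls v <-> peq u v.
Proof. exact: pres_classP. Qed.

Lemma cls_cat u v : cls (u ++ v) = (cls u * cls v)%g.
Proof. by rewrite -[RHS]/(pres_mul _ _) pres_class_cat. Qed.

Lemma cls_nil : cls [::] = 1%g. Proof. by []. Qed.

Definition letter s : A := cls [:: s].

Lemma cls_cons s w : cls (s :: w) = (letter s * cls w)%g.
Proof. exact: (cls_cat [:: s]). Qed.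

Lemma letter_linv s : letter (linv s) = (letter s)^-1%g.
Proof.
apply/eqP; rewrite eq_sym; apply/eqP; apply: mulg1_eq.
rewrite -cls_cons; apply/cls_eqP; case: s => a b; exact: PresCancel.
Qed.

Lemma letter_gen a : letter (a, true) = raag_gen e a. Proof. by []. Qed.

Lemma letterC s t : e s.1 t.1 -> (letter s * letter t = letter t * letter s)%g.
Proof.
have C a b : e a b -> commute (letter (a, true)) (letter (b, true)).
  move=> eab.
  have : cls (commutator_word a b) = 1%g.
    by apply/cls_eqP; apply: PresRel; exists a, b.
  rewrite /commutator_word !cls_cons cls_nil mulg1.
  rewrite -[(a, false)]/(linv (a, true)) -[(b, false)]/(linv (b, true)) !letter_linv.
  by rewrite -invgM mulgA => /divg1_eq.
have L s' : letter s' = letter (s'.1, true) \/ letter s' = (letter (s'.1, true))^-1%g.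
  case: s' => a [] /=; first by left.
  by right; rewrite -letter_linv.
move=> /C c; have [->|->] := L s; have [->|->] := L t => //.
- exact: commuteV.
- by apply/commute_sym/commuteV/commute_sym.
- by apply/commuteV/commute_sym/commuteV/commute_sym.
Qed.

Lemma cls_rem s w : initial s w -> cls w = (letter s * cls (rem s w))%g.
Proof.
elim: w => [|t w IH]; first by rewrite initial_nil.
rewrite initial_cons /= eq_sym; case: (eqVneq t s) => [->|ts] /=.
  by rewrite cls_cons.
move=> /andP[est i]; rewrite !cls_cons (IH i) !mulgA; congr (_ * _)%g.
by apply: letterC; rewrite e_sym.
Qed.

Lemma shuffle_ind_head s u v : shuffle (s :: u) v ->
  initial s v /\ shuffle u (rem s v).
Proof.
move=> H; split; first by rewrite -(shuffle_initial s H) initial_head.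
by move: (shuffle_rem s H); rewrite /= eqxx.
Qed.

Lemma shuffle_nil v : shuffle [::] v -> v = [::].
Proof.
case: v => [|t v] H //; have := H t.1 t.1.
by rewrite e_irr => /(_ isT); rewrite /proj /= eqxx.
Qed.

Lemma shuffle_size u v : shuffle u v -> size u = size v.
Proof.
elim: u v => [|s u IH] v; first by move=> /shuffle_nil ->.
move=> /shuffle_ind_head[i H] /=; rewrite (IH _ H) size_rem ?initial_mem //.
by rewrite prednK //; case: v i {H} => //; rewrite initial_nil.
Qed.

Lemma cls_lmul s w : cls (lmul s w) = (letter s * cls w)%g.
Proof.
rewrite /lmul; case: ifPn => i; last by rewrite cls_cons.
by rewrite (cls_rem i) mulgA letter_linv mulgV mul1g.
Qed.

Lemma cls_nf w : cls (nf w) = cls w.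
Proof. by elim: w => //= s w IH; rewrite cls_lmul IH cls_cons. Qed.

Lemma nf_reduced w : reduced w -> nf w = w.
Proof. by elim: w => //= s w IH /andP[i r]; rewrite IH // /lmul (negbTE i). Qed.

(** Neither [len] nor [ini] depends on the chosen representative, by [shuffle_repr]; [len_cls] and
    [len_rep] identify [len] with the word length. *)
Definition len (g : A) : nat := size (nf (repr g)).
Definition ini (g : A) s : bool := initial s (nf (repr g)).

Lemma shuffle_repr w : shuffle (nf (repr (cls w))) (nf w).
Proof. by apply: nf_peq; apply: repr_pres_class. Qed.

Lemma len_nf w : len (cls w) = size (nf w).
Proof. by rewrite /len (shuffle_size (shuffle_repr w)). Qed.

Lemma len_reduced w : reduced w -> len (cls w) = size w.
Proof. by move=> r; rewrite len_nf nf_reduced. Qed.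

Lemma ini_reduced s w : reduced w -> ini (cls w) s = initial s w.
Proof. by move=> r; rewrite /ini (shuffle_initial s (shuffle_repr w)) nf_reduced. Qed.

Lemma reduced_rep (g : A) : exists2 w, reduced w & g = cls w.
Proof.
exists (nf (repr g)); first exact: reduced_nf.
by rewrite cls_nf /cls pres_classK.
Qed.

Implicit Types g h p q : A.

Lemma ini_len s g : ini g s -> 0 < len g.
Proof.
have [w r ->] := reduced_rep g; rewrite ini_reduced // len_reduced //.
by case: w {r} => //; rewrite initial_nil.
Qed.

Lemma len_letterM s g :
  len (letter s * g)%g = if ini g (linv s) then (len g).-1 else (len g).+1.
Proof.
have [w r ->] := reduced_rep g; rewrite -cls_lmul ini_reduced // !len_reduced //;
  last exact: reduced_lmul.
by rewrite /lmul; case: ifPn => // i; rewrite size_rem ?initial_mem.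
Qed.

Lemma ini_letterM_adj s t g : e t.1 s.1 -> ini (letter s * g)%g t = ini g t.
Proof.
move=> ets; have [w r ->] := reduced_rep g.
rewrite -cls_lmul !ini_reduced //; last exact: reduced_lmul.
rewrite /lmul; case: ifPn => i; first by rewrite initial_rem_adj.
rewrite initial_cons ets /=; case: eqP => // E.
by rewrite E e_irr in ets.
Qed.

Lemma ini_letterM s g : ini (letter s * g)%g s = ~~ ini g (linv s).
Proof.
have [w r ->] := reduced_rep g; rewrite -cls_lmul !ini_reduced //; last exact: reduced_lmul.
rewrite /lmul; case: ifPn => i; last by rewrite initial_head.
by have [_] := reduced_rem r i; rewrite linvK => /negbTE.
Qed.

Lemma ini_letterM_other s t g : ini (letter s * g)%g s -> ini (letter s * g)%g t ->
  t = s \/ e t.1 s.1 /\ ini g t.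
Proof.
rewrite ini_letterM => /negbTE i; have [w r E] := reduced_rep g.
rewrite E in i *; rewrite ini_reduced // in i.
rewrite -cls_lmul !ini_reduced //; last exact: reduced_lmul.
by rewrite /lmul i initial_cons => /orP[/eqP|/andP[]]; [left|right].
Qed.

Lemma ini_adj s t g : ini g s -> ini g t -> s <> t -> e s.1 t.1.
Proof. by move=> i j /eqP; apply: initial_adj i j. Qed.

Lemma ini_neq_linv s g : ini g s -> ~~ ini g (linv s).
Proof.
move=> i; apply/negP => j; have := ini_adj i j.
by rewrite /= e_irr => /(_ (fun E => negP (linv_neq s) (introT eqP (esym E)))).
Qed.

Lemma len1 : len 1%g = 0.
Proof. by rewrite -cls_nil len_nf. Qed.

Lemma ini_exists g : g <> 1%g -> exists s, ini g s.
Proof.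
have [[|s w] r ->] := reduced_rep g; first by [].
by move=> _; exists s; rewrite ini_reduced // initial_head.
Qed.

Lemma iniP s g : ini g s <-> len ((letter s)^-1 * g)%g < len g.
Proof.
rewrite -letter_linv len_letterM linvK; case: ifPn => i; last by split=> //; lia.
by split=> // _; have := ini_len i; lia.
Qed.

Lemma ini_lenV s g : ini g s -> len ((letter s)^-1 * g)%g = (len g).-1.
Proof. by move=> i; rewrite -letter_linv len_letterM linvK i. Qed.

Lemma raag_ind (P : A -> Prop) : P 1%g ->
  (forall s g, ~~ ini g (linv s) -> P g -> P (letter s * g)%g) -> forall g, P g.
Proof.
move=> P1 PS g; have [w r ->] := reduced_rep g.
elim: w r => [|s w IH] //= /andP[i r]; rewrite cls_cons; apply: PS (IH r).
by rewrite ini_reduced.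
Qed.

Lemma len_cls w : len (cls w) <= size w.
Proof.
elim: w => [|s w IH]; first by rewrite cls_nil len1.
by rewrite cls_cons len_letterM /=; case: ifP => _; lia.
Qed.

Lemma len_rep g : exists2 w, g = cls w & len g = size w.
Proof. by have [w r ->] := reduced_rep g; exists w; rewrite ?len_reduced. Qed.

Lemma lenM g h : len (g * h)%g <= len g + len h.
Proof.
have [u -> ->] := len_rep g; have [v -> ->] := len_rep h.
by rewrite -cls_cat -size_cat len_cls.
Qed.

Lemma cls_inv w : cls (inv_word w) = (cls w)^-1%g.
Proof.
elim: w => [|s w IH]; first by rewrite /inv_word /= invg1.
have -> : inv_word (s :: w) = inv_word w ++ [:: linv s].
  by rewrite /inv_word /= rev_cons -cats1.
by rewrite cls_cat IH (cls_cons s w) invgM -letter_linv.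
Qed.

Lemma lenV g : len g^-1%g = len g.
Proof.
have L h : len h^-1%g <= len h.
  have [w -> ->] := len_rep h; rewrite -cls_inv.
  by apply: leq_trans (len_cls _) _; rewrite /inv_word size_rev size_map.
by apply/eqP; rewrite eqn_leq L -{1}(invgK g) L.
Qed.

Lemma len_letter s : len (letter s) = 1.
Proof. by rewrite len_reduced //= initial_nil. Qed.

Lemma len_Mletter g s :
  len (g * letter s)%g = if ini g^-1%g s then (len g).-1 else (len g).+1.
Proof. by rewrite -lenV invgM -letter_linv len_letterM linvK lenV. Qed.

(** Induction moves the first letter [s] of [s p] over to [q]. A common initial letter of [p] and
    [s^-1 q] is either [s^-1], excluded since [s] does not cancel in [s p], or it commutes with [s]
    and was already initial in both [s p] and [q]. *)
Lemma len_no_cancel p q : (forall s, ini p s -> ini q s -> False) ->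
  len (p^-1 * q)%g = len p + len q.
Proof.
elim/raag_ind: p q => [|s p ip IH] q H; first by rewrite invg1 mul1g len1.
have is_ : ini (letter s * p)%g s by rewrite ini_letterM.
have iq : ini q s = false by apply/negP; apply: H is_.
have iqs : ini ((letter s)^-1 * q)%g (linv s).
  by rewrite -letter_linv ini_letterM linvK iq.
rewrite invgM -mulgA IH.
  by rewrite -letter_linv !len_letterM linvK iq (negbTE ip) addSnnS.
move=> t itp itq; rewrite -letter_linv in iqs itq.
case: (ini_letterM_other iqs itq) => [E|[ets iqt]].
  by move: ip; rewrite -E itp.
by apply: (H t) => //; rewrite ini_letterM_adj.
Qed.

Lemma ini_prefix p q s : len (p * q)%g = len p + len q -> ini p s -> ini (p * q)%g s.
Proof.
move=> E i; apply/iniP; rewrite E mulgA.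
apply: leq_ltn_trans (lenM _ _) _; rewrite ltn_add2r; exact/iniP.
Qed.

Lemma nf_size_eq w : size (nf w) = size w -> reduced w.
Proof.
elim: w => [|s w IH] //= E.
have L : size (nf w) <= size w by rewrite -len_nf len_cls.
move: E; rewrite /lmul; case: ifPn => i E.
  rewrite size_rem ?initial_mem // in E.
  by move: (leq_pred (size (nf w))); rewrite E => /leq_trans /(_ L); rewrite ltnn.
move: E => /= -[/IH r]; rewrite r andbT.
by rewrite nf_reduced in i.
Qed.

Lemma initial_rcons s t w : initial t (rcons w s) -> ~~ initial t w ->
  t = s /\ all (fun x => e t.1 x.1) w.
Proof.
elim: w => [|x w IH] /=; rewrite initial_cons.
  by rewrite initial_nil andbF orbF => /eqP ->.
rewrite initial_cons; case: (t == x) => //= /andP[-> i] /= n; exact: IH.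
Qed.

(* The letter s can become initial in g s only by sliding in front of all of g. *)
Lemma ini_Mletter g s t : len (g * letter s)%g = (len g).+1 ->
  ini (g * letter s)%g t -> ~~ ini g t -> t = s /\ commute (letter s) g.
Proof.
have [w r ->] := reduced_rep g.
have -> : (cls w * letter s)%g = cls (rcons w s) by rewrite -cats1 cls_cat.
rewrite len_nf len_reduced // -(size_rcons w s) => /nf_size_eq r'.
rewrite !ini_reduced // => i n; have [Et a] := initial_rcons i n; split=> //.
rewrite -Et {s Et i r r' n}; elim: w a => [|x w IH] /=.
  by rewrite cls_nil => _; apply: commute1.
move=> /andP[etx a]; rewrite cls_cons; apply: commuteM; last exact: IH.
exact: letterC.
Qed.

(** * The axis of a closed walk in the complement graph *)

Fixpoint exponent w : int :=
  if w is s :: v then ((if s.2 then 1 else -1) + exponent v)%R else 0%R.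

Lemma exponent_cat u v : exponent (u ++ v) = (exponent u + exponent v)%R.
Proof. by elim: u => [|s u IH] /=; rewrite ?add0r // IH addrA. Qed.

Lemma exponent_peq u v : peq u v -> exponent u = exponent v.
Proof.
elim=> {u v}[w|v w _ IH|u v w _ IH1 _ IH2|v v' w w' _ IH1 _ IH2|a b|w [a [b [eab ->]]]] //.
- by rewrite IH1.
- by rewrite !exponent_cat IH1 IH2.
- by case: b.
Qed.

(** The homomorphism to the integers that sends every generator to 1. *)
Definition chi (g : A) : int := exponent (repr g).

Lemma chi_cls w : chi (cls w) = exponent w.
Proof. by apply: exponent_peq; apply: repr_pres_class. Qed.

Lemma chiM g h : chi (g * h)%g = (chi g + chi h)%R.
Proof.
have [u _ ->] := reduced_rep g; have [v _ ->] := reduced_rep h.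
by rewrite -cls_cat !chi_cls exponent_cat.
Qed.

Lemma chi1 : chi 1%g = 0%R.
Proof. by rewrite -cls_nil chi_cls. Qed.

Lemma chiV g : chi g^-1%g = (- chi g)%R.
Proof. by apply/eqP; rewrite -addr_eq0 addrC -chiM mulgV chi1. Qed.

Lemma chiX g n : chi (g ^+ n)%g = (chi g *+ n)%R.
Proof. by elim: n => [|n IH]; rewrite ?chi1 // expgS chiM IH mulrS. Qed.

Section Axis.
Variables (al : nat -> V) (m : nat).
Hypothesis al_step : forall i, (al i != al i.+1) && ~~ e (al i) (al i.+1).
Hypothesis al_period : forall i, al (i + m) = al i.
Hypothesis al_cover : forall i c, exists2 j, j < m & al (i + j) = c.

Definition axis_word i k : word V := [seq (al j, true) | j <- iota i k].
Definition axis i k : A := cls (axis_word i k).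

Lemma axis_period_gt0 : 0 < m.
Proof. by have [j] := al_cover 0 (al 0); case: m. Qed.

Lemma axisS i k : axis i k.+1 = (letter (al i, true) * axis i.+1 k)%g.
Proof. exact: cls_cons. Qed.

Lemma axisD i k l : axis i (k + l) = (axis i k * axis (i + k) l)%g.
Proof. by rewrite /axis /axis_word iotaD map_cat cls_cat. Qed.

Lemma axis_word_reduced i k : reduced (axis_word i k).
Proof.
elim: k i => //= k IH i; rewrite IH andbT.
by apply/negP => /initial_mem /mapP[j _].
Qed.

Lemma len_axis i k : len (axis i k) = k.
Proof. by rewrite len_reduced ?axis_word_reduced // size_map size_iota. Qed.

Lemma chi_axis i k : chi (axis i k) = Posz k.
Proof. by rewrite chi_cls; elim: k i => //= k IH i; rewrite IH. Qed.

Lemma axis_period i k : axis (i + m) k = axis i k.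
Proof.
rewrite /axis /axis_word -[(i + m)%N]addnC iotaDl -map_comp; congr cls.
by apply: eq_map => j /=; rewrite addnC al_period.
Qed.

Lemma axisM N : axis 0 (N * m) = (axis 0 m ^+ N)%g.
Proof.
elim: N => [|N IH]; first by rewrite mul0n expg0.
rewrite mulSn axisD expgS -IH add0n; congr (_ * _)%g.
by rewrite -{1}[m]add0n axis_period.
Qed.

(* The word al_i ... al_(i+k-1) is a prefix of a reduced word for g. *)
Definition pre i k g : bool := len ((axis i k)^-1 * g)%g + k == len g.

(** The opposite inequality is the triangle inequality. *)
Lemma preP i k g : reflect (len ((axis i k)^-1 * g)%g + k <= len g) (pre i k g).
Proof.
apply: (iffP eqP) => [->//|H]; apply/eqP; rewrite eqn_leq H /=.
have := lenM (axis i k) ((axis i k)^-1 * g)%g.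
by rewrite mulgA mulgV mul1g len_axis addnC.
Qed.

Lemma pre0 i g : pre i 0 g.
Proof. by rewrite /pre /axis /axis_word /= cls_nil invg1 mul1g addn0. Qed.

Lemma preS i k g : pre i k.+1 g =
  ini g (al i, true) && pre i.+1 k ((letter (al i, true))^-1 * g)%g.
Proof.
have E : ((axis i k.+1)^-1 * g = (axis i.+1 k)^-1 * ((letter (al i, true))^-1 * g))%g.
  by rewrite axisS invgM mulgA.
apply/idP/andP => [/eqP|[i0 /eqP]]; rewrite ?E => H.
  have L : len ((letter (al i, true))^-1 * g)%g <= (len g).-1.
    rewrite -H addnS /= -{2}(len_axis i.+1 k) addnC.
    set z := (letter _)^-1%g; rewrite -{1}[(z * g)%g](mulVKg (axis i.+1 k)).
    exact: lenM.
  have i0 : ini g (al i, true).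
    by apply/iniP; apply: leq_ltn_trans L _; rewrite prednK -?H ?addnS.
  by split=> //; apply/preP; rewrite (ini_lenV i0) -H addnS.
by apply/preP; rewrite E addnS H (ini_lenV i0) prednK // (ini_len i0).
Qed.

Lemma preD i k l g : pre i (k + l) g = pre i k g && pre (i + k) l ((axis i k)^-1 * g)%g.
Proof.
elim: k i g => [|k IH] i g.
  by rewrite pre0 addn0 /axis /axis_word /= cls_nil invg1 mul1g.
by rewrite addSn !preS IH -andbA axisS invgM mulgA addSnnS.
Qed.

Lemma pre_le i k l g : l <= k -> pre i k g -> pre i l g.
Proof. by move=> /subnKC <-; rewrite preD => /andP[]. Qed.

Lemma pre_len i k g : pre i k g -> k <= len g.
Proof. by move=> /eqP <-; apply: leq_addl. Qed.

(** Distinct initial letters are adjacent, so [s] commutes with [al i] and stays initial after its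
    removal. It is not [al i.+1], which is not adjacent to [al i], so the argument repeats. *)
Lemma pre_ini_other i k g s : pre i k g -> ini g s -> s <> (al i, true) ->
  forall j, j < k -> e s.1 (al (i + j)).
Proof.
elim: k i g => // k IH i g; rewrite preS => /andP[i0 p] is_ ns.
have es : e s.1 (al i) by apply: (ini_adj is_ i0).
case=> [_|j jk]; first by rewrite addn0.
rewrite addnS -addSn; apply: IH p _ _ _ jk.
  by rewrite -letter_linv ini_letterM_adj.
move=> Es; move: es; rewrite Es /= e_sym.
by have /andP[_ /negbTE ->] := al_step i.
Qed.

(** Among [m] consecutive letters is the generator of [s] itself, which is not adjacent to
    itself. *)
Lemma pre_ini i g s : pre i m g -> ini g s -> s = (al i, true).
Proof.
move=> p is_; case: (eqVneq s (al i, true)) => // /eqP ns.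
have [j jm E] := al_cover i s.1.
by have := pre_ini_other p is_ ns jm; rewrite E e_irr.
Qed.

Lemma pre_contracting i p q : ~~ ini p (al i, true) -> pre i m q ->
  len (p^-1 * q)%g = len p + len q.
Proof.
move=> np pq; apply: len_no_cancel => s sp sq.
by move: np; rewrite -(pre_ini pq sq) sp.
Qed.

Definition progress g : nat := \max_(k < (len g).+1 | pre 0 k g) k.

Lemma pre_progress g : pre 0 (progress g) g.
Proof.
rewrite /progress; case: (@eq_bigmax_cond _ [pred k : 'I_(len g).+1 | pre 0 k g] val).
  by apply/card_gt0P; exists ord0; rewrite inE pre0.
by move=> k kp E; rewrite E.
Qed.

Lemma leq_progress k g : pre 0 k g -> k <= progress g.
Proof.
move=> p; have kl : k < (len g).+1 by rewrite ltnS (pre_len p).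
exact: (@leq_bigmax_cond _ _ (fun k : 'I_(len g).+1 => k : nat) (Ordinal kl)).
Qed.

Lemma progress_ini g : ~~ ini ((axis 0 (progress g))^-1 * g)%g (al (progress g), true).
Proof.
apply/negP => i; suff /leq_progress : pre 0 (progress g).+1 g by rewrite ltnn.
by rewrite -addn1 preD pre_progress add0n preS i pre0.
Qed.

Lemma progress_len g : progress g <= len g.
Proof. exact: pre_len (pre_progress g). Qed.

(** Both elements are divided by the longest prefix that [p] shares with the axis. Then [p] does not
    begin with the next letter while [q] begins with the next [m] letters, so [pre_contracting]
    makes the distance at least what is left of [p]. *)
Lemma progress_far p q : progress p + m <= progress q ->
  len p <= len (p^-1 * q)%g + progress p.
Proof.
move=> H; have := pre_le H (pre_progress q); rewrite preD add0n => /andP[_ pq].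
have := pre_contracting (progress_ini p) pq.
rewrite invgM invgK -mulgA mulVKg => ->.
by have /eqP <- := pre_progress p; rewrite addnAC leq_addr.
Qed.

(** Common first letters of [g] and [g s] are peeled off. If [al i] is initial in [g s] only, then
    it is [s] and commutes with [g]; were [k] at least 2, [g s] would begin with both [al i] and
    [al i.+1], which are not adjacent. *)
Lemma pre_Mletter_up i k g s : len (g * letter s)%g = (len g).+1 ->
  pre i k (g * letter s)%g -> pre i k.-1 g.
Proof.
elim: k i g => [|k IH] i g L; first by rewrite !pre0.
rewrite preS => /andP[i0] pk /=; case: k IH pk => [|k] IH pk; first exact: pre0.
case: (boolP (ini g (al i, true))) => i1.
  rewrite preS i1 /=; rewrite mulgA in pk; apply: IH pk.
  by rewrite -mulgA !ini_lenV // L prednK // (ini_len i1).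
have [Es c] := ini_Mletter L i0 i1.
have E : ((letter (al i, true))^-1 * (g * letter s) = g)%g.
  by rewrite Es -c mulKg.
move: pk; rewrite E preS => /andP[i2 _].
have i3 : ini (g * letter s)%g (al i.+1, true).
  by apply: ini_prefix => //; rewrite L len_letter addn1.
have /andP[n1 n2] := al_step i.
suff : e (al i) (al i.+1) by rewrite (negbTE n2).
by apply: (ini_adj i0 i3) => -[E']; rewrite E' eqxx in n1.
Qed.

Lemma pre_Mletter i k g s : pre i k (g * letter s)%g -> pre i k.-1 g.
Proof.
move=> p; have := len_Mletter g s; case: ifP => [i0 L|_ L]; last exact: pre_Mletter_up L p.
apply: (@pre_le i k); first exact: leq_pred.
have := ini_len i0; rewrite lenV => lg.
apply/preP; move/eqP: p; rewrite L => E.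
rewrite -(prednK lg) -E -addSn leq_add2r.
have := lenM ((axis i k)^-1 * (g * letter s))%g (letter s)^-1%g.
by rewrite lenV len_letter -!mulgA mulgV mulg1 addn1.
Qed.

Lemma progress_Mletter g s : progress (g * letter s)%g <= (progress g).+1.
Proof.
have := leq_progress (pre_Mletter (pre_progress (g * letter s)%g)).
by case: (progress _) => // k.
Qed.

Lemma progressM g h : progress (g * h)%g <= progress g + len h.
Proof.
have [w -> ->] := len_rep h; elim: w g => [|s w IH] g; first by rewrite cls_nil mulg1 addn0.
rewrite cls_cons mulgA; apply: leq_trans (IH _) _.
by rewrite /= addnS -addSn leq_add2r progress_Mletter.
Qed.

Lemma progress_axis k : k <= progress (axis 0 k).
Proof. by apply: leq_progress; rewrite /pre mulVg len1 len_axis. Qed.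

(* Write h u = u h for a long axis word u.  After cancellation the left side is h' u',
   with u' a final part of u, while the right side begins with a long part of u; this
   forces h to be of the form u_k u_c^-1 with u_k, u_c prefixes of u. *)
Lemma commute_axis_eq1 h : commute h (axis 0 m) -> chi h = 0%R -> h = 1%g.
Proof.
(* Multiplying the axis word of length [K] by [h] spoils at most [n] letters of it; [n + m] must
   survive, since [k + m] of them are used below and [k <= n]. *)
move=> ch ch0; pose n := len h; pose N := n + n + m; pose K := N * m.
have KN : N <= K by rewrite leq_pmulr // axis_period_gt0.
have cK : commute h (axis 0 K) by rewrite /K axisM; apply: commuteX.
pose c := progress h^-1%g.
have cn : c <= n by rewrite -[n]lenV; apply: progress_len.
pose p' := ((axis 0 c)^-1 * h^-1)%g; pose h' := (h * axis 0 c)%g.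
have Ep : p' = h'^-1%g by rewrite /p' /h' invgM.
pose q' := axis c (K - c).
have Eh : (h * axis 0 K = h' * q')%g.
  have EK : K = c + (K - c) by rewrite subnKC //; lia.
  by rewrite {1}EK axisD mulgA add0n.
have Ln : len (h' * q')%g = len h' + len q'.
  rewrite -[h']invgK -Ep lenV; apply: (@pre_contracting c); first exact: progress_ini.
  apply: (@pre_le c (K - c)); first by lia.
  by rewrite /pre /q' mulVg len1 len_axis.
have lh' : len h' <= n.
  rewrite -lenV -Ep; have := pre_progress h^-1%g; rewrite /pre -/c -/p' lenV => /eqP.
  by rewrite -/n => <-; rewrite leq_addr.
pose k := progress h'; have kn : k <= n by apply: leq_trans (progress_len _) lh'.
pose p := ((axis 0 k)^-1 * h')%g.
have pK : pre 0 (k + m) (h' * q')%g.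
  apply: pre_le (pre_progress _); rewrite -Eh cK.
  have := progressM (axis 0 K * h)%g h^-1%g; rewrite mulgK lenV.
  by have := progress_axis K; lia.
have pm : pre k m (p * q')%g by move: pK; rewrite preD add0n mulgA => /andP[].
have Lp : len (p * q')%g = len p + len q'.
  apply/eqP; rewrite eqn_leq lenM /=.
  have := lenM (axis 0 k) (p * q')%g.
  rewrite [X in len X]mulgA mulVKg Ln len_axis.
  have /eqP := pre_progress h'; rewrite -/k -/p; lia.
have p1 : p = 1%g.
  apply/eqP; apply: contraT => /eqP /ini_exists[s sp].
  have := pre_ini pm (ini_prefix Lp sp) => Es.
  by have := progress_ini h'; rewrite -/k -/p -Es sp.
have h'E : h' = axis 0 k by rewrite -(mulVKg (axis 0 k) h') -/p p1 mulg1.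
have hE : h = (axis 0 k * (axis 0 c)^-1)%g by rewrite -h'E mulgK.
move: ch0; rewrite hE chiM chiV !chi_axis => /eqP; rewrite subr_eq0 => /eqP [->].
by rewrite mulgV.
Qed.

Lemma commute_axis_inj x y : commute x (axis 0 m) -> commute y (axis 0 m) ->
  chi x = chi y -> x = y.
Proof.
move=> cx cy E; apply: divg1_eq; apply: commute_axis_eq1.
  by apply/commute_sym/commuteM => //; apply: commuteV.
by rewrite chiM chiV E subrr.
Qed.

(** If [g] and [h] commute with the components of [w], suitable powers of [(g, 1)] and [(1, h)] have
    the same exponent sum, hence agree, hence are 1. So one of the two elements has exponent sum 0
    and is 1 itself. Applied to the components of [w] and to [g0] or [h0], this gives [w = 1]. *)
Lemma axis_no_product : ~ nontrivial_direct_product (raag e).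
Proof.
move=> [G [H [[g0 g0P] [h0 h0P] [f [fM [f' fK f'K]]]]]].
pose w := axis 0 m.
have f1 : f 1%g = 1%g.
  by apply: (mulgI (f 1%g)); rewrite -fM !mulg1.
have f'M : {morph f' : x y / (x * y)%g}.
  by move=> x y; apply: (can_inj fK); rewrite fM !f'K.
have cf x : commute x (f w) -> commute (f' x) w.
  by move=> c; apply: (can_inj fK); rewrite !fM f'K.
have split (g : G) (h : H) : commute g (f w).1 -> commute h (f w).2 -> g = 1%g \/ h = 1%g.
  move=> cg ch.
  pose x := f' (g, 1%g); pose y := f' (1%g, h).
  have cx : commute x w.
    apply: cf; case: (f w) cg => w1 w2 /= cg.
    by rewrite /commute -[LHS]/((g * w1)%g, (1 * w2)%g) cg mul1g -[w2 in LHS]mulg1.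
  have cy : commute y w.
    apply: cf; case: (f w) ch => w1 w2 /= ch.
    by rewrite /commute -[LHS]/((1 * w1)%g, (h * w2)%g) ch mul1g -[w1 in LHS]mulg1.
  have f'1 : f' (1%g, 1%g) = 1%g by rewrite -[(1%g, 1%g)]f1 fK.
  have fX (z : A) n : f (z ^+ n)%g = (f z ^+ n)%g.
    by elim: n => [|n IH]; rewrite ?expg0 // !expgS fM IH.
  have pX (a : G) (b : H) n : ((a, b) ^+ n)%g = ((a ^+ n)%g, (b ^+ n)%g).
    by elim: n => [|n IH] //; rewrite !expgS IH.
  have xy n k : (x ^+ n)%g = (y ^+ k)%g -> (x ^+ n)%g = 1%g.
    move=> E; move: (congr1 f E); rewrite !fX !f'K !pX !expg1n => -[E1 _].
    by apply: (can_inj fK); rewrite fX f'K pX E1 expg1n f1.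
  have xyV n k : (x ^+ n)%g = (y^-1 ^+ k)%g -> (x ^+ n)%g = 1%g.
    have -> : y^-1%g = f' (1%g, h^-1%g).
      apply/eqP; rewrite eq_sym -[_ == _]eqg_inv invgK; apply/eqP.
      by apply: mulg1_eq; rewrite -f'M -[(_ * _)%g]/((1 * 1)%g, (h^-1 * h)%g) mulVg mul1g.
    move=> E; move: (congr1 f E); rewrite !fX !f'K !pX !expg1n => -[E1 _].
    by apply: (can_inj fK); rewrite fX f'K pX E1 expg1n f1.
  have key : chi x = 0%R \/ chi y = 0%R.
    have [j0|j0] := eqVneq (chi y) 0%R; [by right|left].
    have cX (z : A) n : commute z w -> commute (z ^+ n)%g w.
      by move=> c; apply/commute_sym/commuteX/commute_sym.
    have x1 : (x ^+ absz (chi y))%g = 1%g.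
      (* Exponents must be natural numbers; when [chi x] and [chi y] have opposite signs, [y^-1]
         replaces [y]. *)
      have [E|E] : (chi x * (absz (chi y))%:Z = chi y * (absz (chi x))%:Z \/
                   chi x * (absz (chi y))%:Z = - (chi y * (absz (chi x))%:Z))%R.
        by rewrite !abszE; case: (ger0P (chi x)); case: (ger0P (chi y)) => _ _;
           [left|right|right|left]; ring.
      - apply: (xy _ (absz (chi x))); apply: commute_axis_inj; rewrite ?chiX; try exact: cX.
        by rewrite -[LHS]mulr_natr -[RHS]mulr_natr !natz.
      - apply: (xyV _ (absz (chi x))); apply: commute_axis_inj; rewrite ?chiX ?chiV; try exact: cX.
          by apply: cX; apply/commute_sym/commuteV/commute_sym.
        by rewrite -[LHS]mulr_natr -[RHS]mulr_natr !natz E mulNr.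
    move: (congr1 chi x1); rewrite chiX chi1 => /eqP; rewrite mulrn_eq0 absz_eq0 (negbTE j0) /=.
    by move=> /eqP.
  case: key => /commute_axis_eq1 => [/(_ cx) E|/(_ cy) E]; [left|right].
    by move: (congr1 f E); rewrite f'K f1 => -[].
  by move: (congr1 f E); rewrite f'K f1 => -[].
have w1 : w <> 1%g.
  move=> E; have := axis_period_gt0; rewrite -(len_axis 0 m) -/w E len1 //.
have c1 : commute (f w).1 (f w).1 by [].
have c2 : commute (f w).2 (f w).2 by [].
have trivial1 : (f w).1 = 1%g /\ (f w).2 = 1%g.
  have [E|E] := split _ _ c1 c2.
    have c0 : commute g0 (f w).1 by rewrite E; apply: commute1.
    by have [//|->] := split _ _ c0 c2.
  have c0 : commute h0 (f w).2 by rewrite E; apply: commute1.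
  by have [->|//] := split _ _ c1 c0.
apply: w1; apply: (can_inj fK); rewrite f1.
by case: (f w) trivial1 => ? ? /= [-> ->].
Qed.

End Axis.

(** * Closed walks in the complement graph *)

Definition opposed : rel V := [rel a b | (a != b) && ~~ e a b].

Lemma covering_path (s : seq V) (v : V) : (forall a b, connect opposed a b) ->
  exists2 p, path opposed v p & {subset s <= v :: p}.
Proof.
move=> conn; elim: s => [|x s [p pp sp]]; first by exists [::].
have /connectP[q qq Ex] := conn (last v p) x.
exists (p ++ q); first by rewrite cat_path pp.
have lx : x \in v :: p ++ q by rewrite Ex -last_cat mem_last.
by move=> y; rewrite inE => /predU1P[->//|/sp]; rewrite !inE mem_cat orbA => ->.
Qed.

Lemma exists_axis : 1 < #|V| -> (forall a b, connect opposed a b) ->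
  exists (al : nat -> V) (m : nat),
   [/\ forall i, (al i != al i.+1) && ~~ e (al i) (al i.+1),
       forall i, al (i + m) = al i &
       forall i c, exists2 j, j < m & al (i + j) = c].
Proof.
move=> V1 conn; have /card_gt0P[v _] : 0 < #|V| by apply: ltnW.
have [p pp sp] := covering_path (enum V) v conn.
have /connectP[q qq Ev] := conn (last v p) v.
(* The list omits the starting point [v] but ends in it, so its periodic repetition spells the
   closed walk. *)
pose c := p ++ q.
have cc : path opposed v c by rewrite cat_path pp.
have lc : last v c = v by rewrite last_cat.
have c0 : 0 < size c.
  rewrite /c size_cat; case: (p) sp => //= sp'.
  have : #|V| <= size [:: v] by rewrite cardE uniq_leq_size ?enum_uniq.
  by rewrite /= leqNgt V1.
have vc : v \in c.
  by case: c cc lc c0 => //= x s _ <- _; apply: mem_last.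
have mc x : x \in c.
  have : x \in v :: p by apply: sp; rewrite mem_enum.
  by rewrite inE => /predU1P[->//|xp]; rewrite mem_cat xp.
pose m := size c; exists (fun i => nth v c (i %% m)), m; split.
- move=> i; have im : i %% m < m by rewrite ltn_mod.
  have := pathP v cc; rewrite -/m => H.
  have [E|ne] := eqVneq (i %% m).+1 m.
    have -> : i.+1 %% m = 0 by rewrite -addn1 -modnDml addn1 E modnn.
    have -> : nth v c (i %% m) = v by have -> : i %% m = m.-1 := congr1 predn E; rewrite nth_last.
    by have := H 0 c0.
  have lt : (i %% m).+1 < m by rewrite ltn_neqAle ne.
  have -> : i.+1 %% m = (i %% m).+1 by rewrite -addn1 -modnDml addn1 modn_small.
  by have := H _ lt.
- by move=> i; rewrite modnDr.
- move=> i x; pose k := index x c; have km : k < m by rewrite index_mem.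
  (* The shift that makes [i + j] congruent to the position [k] of [x]. *)
  exists ((k + (m - i %% m)) %% m); first by rewrite ltn_mod.
  have im : i %% m <= m by apply: ltnW; rewrite ltn_mod.
  have -> : i + (k + (m - i %% m)) %% m = k + m %[mod m].
    by rewrite modnDmr {1}(divn_eq i m) -addnA modnMDl; congr (_ %% _); lia.
  by rewrite modnDr modn_small // nth_index.
Qed.

End Words.

(** * Direct products and joins *)

Section Lift.
Context (V : finType) (e : rel V) (K : groupType) (phi : V -> K).
Hypothesis phiC : forall a b, e a b -> commute (phi a) (phi b).

Definition eval_letter (s : V * bool) : K := if s.2 then phi s.1 else ((phi s.1)^-1)%g.
Definition eval_word (w : word V) : K := foldr (fun s x => (eval_letter s * x)%g) 1%g w.

Lemma eval_word_cat u v : eval_word (u ++ v) = (eval_word u * eval_word v)%g.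
Proof. by elim: u => [|s u IH] /=; rewrite ?mul1g // IH mulgA. Qed.

Lemma eval_word_peq u v : pres_eq (raag_rels e) u v -> eval_word u = eval_word v.
Proof.
elim=> {u v}[w|v w _ IH|u v w _ IH1 _ IH2|v v' w w' _ IH1 _ IH2|a b|w [a [b [eab ->]]]] //.
- by rewrite IH1.
- by rewrite !eval_word_cat IH1 IH2.
- by case: b; rewrite /= mulg1 ?mulgV ?mulVg.
- by rewrite /= /eval_letter /= mulg1 mulgA (phiC eab) -mulgA mulVKg mulgV.
Qed.

Definition raag_lift (g : raag e) : K := eval_word (repr g).

Lemma raag_lift_cls w : raag_lift (cls e w) = eval_word w.
Proof. by apply: eval_word_peq; apply: repr_pres_class. Qed.

Lemma raag_liftM : {morph raag_lift : x y / (x * y)%g}.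
Proof.
move=> x y; rewrite -(pres_classK x) -(pres_classK y).
by rewrite -!/(cls e _) -cls_cat !raag_lift_cls eval_word_cat.
Qed.

Lemma raag_lift_gen a : raag_lift (raag_gen e a) = phi a.
Proof. by rewrite -letter_gen raag_lift_cls /= mulg1. Qed.

End Lift.

Section HomExt.
Context (V : finType) (e : rel V) (K : groupType).

Lemma hom_ext (f1 f2 : raag e -> K) : {morph f1 : x y / (x * y)%g} ->
  {morph f2 : x y / (x * y)%g} -> (forall a, f1 (raag_gen e a) = f2 (raag_gen e a)) ->
  f1 =1 f2.
Proof.
move=> m1 m2 E g; rewrite -(pres_classK g) -/(cls e _).
have h1 (f : raag e -> K) : {morph f : x y / (x * y)%g} -> f 1%g = 1%g.
  by move=> m; apply: (mulgI (f 1%g)); rewrite -m !mulg1.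
elim: (repr g) => [|[a b] w IH]; first by rewrite cls_nil !h1.
rewrite cls_cons m1 m2 IH; congr (_ * _)%g; case: b; first exact: E.
have hV (f : raag e -> K) : {morph f : x y / (x * y)%g} ->
    f (letter e (a, false)) = (f (raag_gen e a))^-1%g.
  move=> m; apply/esym/mulg1_eq; rewrite -m -letter_gen.
  by rewrite (letter_linv e (a, true)) mulgV h1.
by rewrite !hV // E.
Qed.

End HomExt.

Section Join.
Context (V : finType) (e : rel V).
Hypotheses (e_sym : symmetric e) (e_irr : irreflexive e).
Variable P : pred V.
Hypothesis P_join : forall a b, P a -> ~~ P b -> e a b.

Definition sub_rel (Q : pred V) : rel {x | Q x} := relpre val e.

(** On generators, the retraction of the group onto the subgroup generated by [Q]. *)
Definition to_sub (Q : pred V) (a : V) : raag (@sub_rel Q) :=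
  if insub a is Some x then raag_gen _ x else 1%g.

Definition of_sub (Q : pred V) (x : {x | Q x}) : raag e := raag_gen e (val x).

Lemma to_subC Q a b : e a b -> commute (to_sub Q a) (to_sub Q b).
Proof.
rewrite /to_sub => eab; case: insubP => [x _ xE|_]; last exact/commute_sym/commute1.
case: insubP => [y _ yE|_]; last exact: commute1.
rewrite /commute -!letter_gen; apply: letterC => /=.
by rewrite /sub_rel /= xE yE.
Qed.

Lemma of_subC (Q : pred V) (x y : {x | Q x}) : @sub_rel Q x y -> commute (of_sub x) (of_sub y).
Proof. by rewrite /of_sub -!letter_gen => exy; apply: letterC. Qed.

Local Notation NP := (fun a => ~~ P a).
Local Notation pi1 := (@raag_lift _ e _ (@to_sub P)).
Local Notation pi2 := (@raag_lift _ e _ (@to_sub NP)).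
Local Notation in1 := (@raag_lift _ (@sub_rel P) _ (@of_sub P)).
Local Notation in2 := (@raag_lift _ (@sub_rel NP) _ (@of_sub NP)).

Lemma inC x y : commute (in1 x) (in2 y).
Proof.
have L2 (a : {x | P x}) y' : commute (of_sub a) (in2 y').
  rewrite -(pres_classK y') -/(cls _ _) raag_lift_cls; last exact: of_subC.
  elim: (repr y') => [|[b s] w IH] /=; first exact: commute1.
  apply: commuteM IH.
  have c : commute (of_sub a) (of_sub b).
    by rewrite /of_sub -!letter_gen; apply: letterC => //; exact: P_join (valP a) (valP b).
  by rewrite /eval_letter /=; case: s => //; apply: commuteV.
rewrite -(pres_classK x) -/(cls _ _) raag_lift_cls; last exact: of_subC.
apply: commute_sym; elim: (repr x) => [|[b s] w IH] /=; first exact: commute1.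
apply: commuteM IH; have /commute_sym c := L2 b y.
by rewrite /eval_letter /=; case: s => //; apply: commuteV.
Qed.

Lemma raag_gen_neq1 a : raag_gen e a <> 1%g.
Proof. by move=> /(congr1 (@len V e)); rewrite -letter_gen len_letter // len1. Qed.

(** The two retractions give the map to the product; its inverse multiplies the two inclusions,
    whose images commute. All identities are checked on generators through [hom_ext]. *)
Lemma join_product a b : P a -> ~~ P b -> nontrivial_direct_product (raag e).
Proof.
move=> Pa Pb.
have M1 := raag_liftM (@to_subC P); have M2 := raag_liftM (@to_subC NP).
have N1 := raag_liftM (@of_subC P); have N2 := raag_liftM (@of_subC NP).
have K1 : cancel in1 pi1.
  apply: (@hom_ext _ _ _ (pi1 \o in1) id) => //= [x y|x]; first by rewrite /= N1 M1.
  rewrite (raag_lift_gen (@of_subC P)) /of_sub (raag_lift_gen (@to_subC P)) /to_sub.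
  by rewrite valK.
have K2 : cancel in2 pi2.
  apply: (@hom_ext _ _ _ (pi2 \o in2) id) => //= [x y|x]; first by rewrite /= N2 M2.
  rewrite (raag_lift_gen (@of_subC NP)) /of_sub (raag_lift_gen (@to_subC NP)) /to_sub.
  by rewrite valK.
have Z1 x : pi1 (in2 x) = 1%g.
  apply: (@hom_ext _ _ _ (pi1 \o in2) (fun=> 1%g)) => //= [{}x y|{}x|{}x].
  - by rewrite /= N2 M1.
  - by rewrite mulg1.
  - rewrite /= (raag_lift_gen (@of_subC NP)) /of_sub (raag_lift_gen (@to_subC P)) /to_sub.
    by rewrite insubN // (valP x).
have Z2 x : pi2 (in1 x) = 1%g.
  apply: (@hom_ext _ _ _ (pi2 \o in1) (fun=> 1%g)) => //= [{}x y|{}x|{}x].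
  - by rewrite /= N1 M2.
  - by rewrite mulg1.
  - rewrite /= (raag_lift_gen (@of_subC P)) /of_sub (raag_lift_gen (@to_subC NP)) /to_sub.
    by rewrite insubN // negbK (valP x).
exists (raag (@sub_rel P)), (raag (@sub_rel NP)); split.
- exists (to_sub P a); rewrite /to_sub insubT => E.
  have := congr1 in1 E; rewrite (raag_lift_gen (@of_subC P)) /of_sub /=.
  have -> : in1 1%g = 1%g by apply: (mulgI (in1 1%g)); rewrite -N1 !mulg1.
  exact: raag_gen_neq1.
- exists (to_sub NP b); rewrite /to_sub insubT => E.
  have := congr1 in2 E; rewrite (raag_lift_gen (@of_subC NP)) /of_sub /=.
  have -> : in2 1%g = 1%g by apply: (mulgI (in2 1%g)); rewrite -N2 !mulg1.
  exact: raag_gen_neq1.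
exists (fun g => (pi1 g, pi2 g)); split.
  by move=> x y; rewrite M1 M2.
exists (fun z => in1 z.1 * in2 z.2)%g => [g|[x y]] /=.
  apply: (@hom_ext _ _ _ (fun g => in1 (pi1 g) * in2 (pi2 g))%g id) => //= [x y|{}c].
    rewrite M1 M2 N1 N2 !mulgA; congr (_ * _)%g; rewrite -!mulgA; congr (_ * _)%g.
    exact: inC.
  rewrite (raag_lift_gen (@to_subC P)) (raag_lift_gen (@to_subC NP)) /to_sub.
  have in11 : in1 1%g = 1%g by apply: (mulgI (in1 1%g)); rewrite -N1 !mulg1.
  have in21 : in2 1%g = 1%g by apply: (mulgI (in2 1%g)); rewrite -N2 !mulg1.
  case: (boolP (P c)) => Pc.
    rewrite insubT insubN ?Pc //= in21 mulg1 (raag_lift_gen (@of_subC P)).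
    by rewrite /of_sub.
  rewrite insubN // insubT /= in11 mul1g (raag_lift_gen (@of_subC NP)).
  by rewrite /of_sub.
by rewrite M1 M2 K1 K2 Z1 Z2 mulg1 mul1g.
Qed.

End Join.

Section ProductCriterion.
Context (V : finType) (e : rel V).
Hypotheses (e_sym : symmetric e) (e_irr : irreflexive e) (V_gt1 : 1 < #|V|).

(** If the complement graph were connected, it would provide an axis, which [axis_no_product]
    excludes. Otherwise one of its components is a side of a join. *)
Lemma product_join : nontrivial_direct_product (raag e) ->
  exists P : pred V, [/\ exists a, P a, exists b, ~~ P b & forall a b, P a -> ~~ P b -> e a b].
Proof.
move=> ndp.
have [/existsP[a /existsP[b nab]]|/existsPn H] :=
    boolP [exists a, exists b, ~~ connect (opposed e) a b]; last first.
  exfalso; have conn a b : connect (opposed e) a b.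
    by have /existsPn /(_ b) := H a; rewrite negbK.
  have [al [m [s p c]]] := exists_axis V_gt1 conn.
  exact: (axis_no_product e_sym e_irr s p c).
exists (connect (opposed e) a); split; [by exists a; apply: connect0|by exists b|].
move=> c d ac nad; apply/negPn/negP => ncd; move/negP: nad; apply.
case: (eqVneq c d) => [<-//|cd]; apply: connect_trans ac _; apply: connect1.
by rewrite /opposed /= cd.
Qed.

Lemma not_product_opposed : ~ nontrivial_direct_product (raag e) ->
  forall a b, connect (opposed e) a b.
Proof.
move=> ndp a b; apply/negPn/negP => nab; apply: ndp.
apply: (@join_product _ _ e_sym e_irr (connect (opposed e) a) _ a b) => // c d ac nad.
apply/negPn/negP => ncd; move/negP: nad; apply.
case: (eqVneq c d) => [<-//|cd]; apply: connect_trans ac _; apply: connect1.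
by rewrite /opposed /= cd.
Qed.

End ProductCriterion.

Local Open Scope ring_scope.

(** * The distance from the base point *)

Section Height.
Context (R : realType) (V : finType) (e : rel V).
Hypotheses (e_sym : symmetric e) (e_irr : irreflexive e).
Local Notation A := (raag e).
Local Notation X := (raag_cover R e).
Implicit Types (g h : A) (s t : {ffun V -> R}) (x y z : X) (S : {pred V}).

(* The derivative in the direction a of the distance from e, on the cubes with
   0-vertex g. *)
Definition slope g a : R := if ini g^-1%g (a, true) then -1 else 1.

Lemma slope_norm g a : `|slope g a| = 1.
Proof. by rewrite /slope; case: ifP => _; rewrite ?normrN normr1. Qed.

Lemma len_slope g a : (len (g * raag_gen e a)%g)%:R = (len g)%:R + slope g a :> R.
Proof.
rewrite -letter_gen len_Mletter // /slope; case: ifP => [i|_]; last by rewrite -natr1.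
have := ini_len e_sym e_irr i; rewrite lenV // => l0.
by rewrite -[in RHS](prednK l0) -natr1 addrK.
Qed.

(** Letters adjacent to [b] do not affect whether [b] is initial. Thus the slope in one direction of
    a cube is unchanged by moves in the others, which makes the distance affine on the cube. *)
Lemma slope_gen g a b : e a b -> slope (g * raag_gen e a)%g b = slope g b.
Proof.
move=> eab; rewrite /slope invgM -letter_gen -letter_linv //.
by rewrite ini_letterM_adj //= e_sym.
Qed.

Lemma cliqueP S : reflect (forall a b, a \in S -> b \in S -> a != b -> e a b) (clique e S).
Proof.
apply: (iffP forallP) => [H a b aS bS ab|H a].
  by have /forallP /(_ b) := H a; rewrite aS bS ab.
by apply/forallP => b; apply/implyP => /and3P[]; apply: H.
Qed.

Lemma len_clique_prod S (r : seq V) g : clique e S -> uniq r -> {subset r <= S} ->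
  (len (g * \big[*%g/1%g]_(a <- r) raag_gen e a)%g)%:R =
    (len g)%:R + \sum_(a <- r) slope g a :> R.
Proof.
move=> /cliqueP cS; elim: r g => [|a r IH] g /=; first by rewrite !big_nil mulg1 addr0.
move=> /andP[ar ur] sr; rewrite !big_cons mulgA IH //; last first.
  by move=> b br; apply: sr; rewrite inE br orbT.
rewrite len_slope addrA; congr (_ + _); apply: eq_big_seq => b br.
rewrite slope_gen //; apply: cS; try by apply: sr; rewrite inE ?eqxx ?br ?orbT.
by apply: contraNneq ar => ->.
Qed.

Lemma slope_clique_prod S (r : seq V) g b : clique e S -> {subset r <= S} -> b \in S ->
  b \notin r -> slope (g * \big[*%g/1%g]_(a <- r) raag_gen e a)%g b = slope g b.
Proof.
move=> /cliqueP cS; elim: r g => [|a r IH] g /=; first by rewrite !big_nil mulg1.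
move=> sr bS; rewrite inE negb_or => /andP[ba br]; rewrite !big_cons mulgA IH //.
  rewrite slope_gen //; apply: cS => //; last by rewrite eq_sym.
  by apply: sr; rewrite inE eqxx.
by move=> c cr; apply: sr; rewrite inE cr orbT.
Qed.

Definition height0 g t : R := (len g)%:R + \sum_a slope g a * t a.

Definition vert x : A := (cover_val x).1.
(** Meant as the distance from the vertex [h]: the word length, extended affinely over cubes. For
    [h = 1] this is proved in [base_dist]. *)
Definition height h x : R := height0 (h^-1 * vert x)%g (cover_val x).2.

Lemma cube_coord_ge0 S t a : cube_coord S t -> 0 <= t a.
Proof. by move=> [/(_ a)/andP[]]. Qed.

Lemma cube_coord_mem S t a : cube_coord S t -> t a != 0 -> a \in S.
Proof. by move=> [_ H] ta; apply: contraNT ta => /H ->. Qed.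

(** Coordinates equal to 1 are absorbed into the vertex by [cube_chart], and their slopes reappear
    as the change of word length. Hence the height does not depend on the closed cube in which it is
    computed. *)
Lemma height0_chart S g t : clique e S -> cube_coord S t ->
  height0 (cube_chart g t).1 (cube_chart g t).2 = height0 g t.
Proof.
move=> cS St; rewrite /height0 /cube_chart /= -big_filter.
set r := [seq a <- index_enum V | t a == 1].
have rS : {subset r <= S}.
  move=> a; rewrite mem_filter => /andP[/eqP ta _]; apply: cube_coord_mem St _.
  by rewrite ta oner_eq0.
rewrite (@len_clique_prod S) ?filter_uniq ?index_enum_uniq // -addrA; congr (_ + _).
rewrite big_filter [RHS](bigID (fun a => t a == 1)) /=; congr (_ + _).
  by apply: eq_bigr => a /eqP ->; rewrite mulr1.
rewrite [LHS](bigID (fun a => t a == 1)) /= big1 ?add0r; last first.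
  by move=> a ta; rewrite ffunE ta mulr0.
apply: eq_bigr => a ta; rewrite ffunE (negbTE ta).
have [->|ta0] := eqVneq (t a) 0; first by rewrite !mulr0.
rewrite (@slope_clique_prod S) //; first exact: cube_coord_mem St ta0.
by rewrite mem_filter (negbTE ta).
Qed.

Lemma height_chart S h g t x : clique e S -> cube_coord S t ->
  cover_val x = cube_chart g t -> height h x = height0 (h^-1 * g)%g t.
Proof.
move=> cS St xE; rewrite -(height0_chart _ cS St) /height /vert xE /cube_chart /=.
by rewrite mulgA.
Qed.

Lemma height0_lip g s t : `|height0 g s - height0 g t| <= l1_dist s t.
Proof.
rewrite /height0 opprD addrACA subrr add0r -sumrB; apply: le_trans (ler_norm_sum _ _ _) _.
by apply: ler_sum => a _; rewrite -mulrBr normrM slope_norm mul1r.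
Qed.

Lemma height_string h x y c : cube_string x y c -> `|height h x - height h y| <= c.
Proof.
elim=> {x y c}[x|x y z g S s t c cS Ss St xE yE _ IH]; first by rewrite subrr normr0.
apply: le_trans (ler_distD (height h y) _ _) _; apply: lerD => //.
by rewrite (height_chart h cS Ss xE) (height_chart h cS St yE) height0_lip.
Qed.

Lemma height_dist h x y : (`|height h x - height h y|%:E <= cover_dist x y)%E.
Proof.
by apply: le_ereal_inf_tmp => _ [c xyc <-]; rewrite lee_fin height_string.
Qed.

Lemma cover_coord x a : 0 <= (cover_val x).2 a < 1.
Proof. by case: x => -[g t] /= /andP[/forallP]. Qed.

Lemma cover_clique x : clique e [pred a | (cover_val x).2 a != 0].
Proof. by case: x => -[g t] /= /andP[_]. Qed.

Lemma cover_cube_coord x : cube_coord [pred a | (cover_val x).2 a != 0] (cover_val x).2.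
Proof.
split=> a; first by have /andP[-> /ltW ->] := cover_coord x a.
by rewrite inE negbK => /eqP.
Qed.

Lemma height_vert h x : `|height h x - (len (h^-1 * vert x)%g)%:R| <= #|V|%:R.
Proof.
rewrite /height /height0 addrAC subrr add0r; apply: le_trans (ler_norm_sum _ _ _) _.
rewrite -sumr_const; apply: ler_sum => a _; rewrite normrM slope_norm mul1r.
by have /andP[? /ltW ?] := cover_coord x a; rewrite ger0_norm.
Qed.

(** The function [height (vert x)] is 1-Lipschitz, and at [x] and [y] it differs by at most [#|V|]
    from the word length. *)
Lemma dist_vert x y :
  (((len ((vert x)^-1 * vert y)%g)%:R - #|V|%:R *+ 2)%:E <= cover_dist x y)%E.
Proof.
apply: le_trans (height_dist (vert x) x y); rewrite lee_fin.
have := height_vert (vert x) x; rewrite mulVg len1 // subr0.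
have := height_vert (vert x) y; set l := (len _)%:R; set N := #|V|%:R.
rewrite !ler_norml => /andP[h1 h2] /andP[h3 h4].
rewrite distrC; apply: le_trans (ler_norm _); lra.
Qed.

Lemma chart_salvetti S g t : clique e S -> cube_coord S t -> in_salvetti e (cube_chart g t).2.
Proof.
move=> /cliqueP cS St; apply/andP; split.
  apply/forallP => a; rewrite ffunE; case: eqP => [_|/eqP t1]; first by rewrite lexx ltr01.
  by case: St => /(_ a)/andP[-> tl] _; rewrite lt_neqAle t1.
apply/cliqueP => a b; rewrite !inE !ffunE.
case: (t a =P 1) => _; first by rewrite eqxx.
case: (t b =P 1) => _; first by rewrite eqxx.
by move=> /(cube_coord_mem St) aS /(cube_coord_mem St) bS; apply: cS.
Qed.

(** The default [cover_base] is taken only when the coordinates do not describe a point of a cube,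
    which [chart_ptE] rules out. *)
Definition chart_pt g t : X := insubd (cover_base R e) (cube_chart g t).

Lemma chart_ptE S g t : clique e S -> cube_coord S t -> cover_val (chart_pt g t) = cube_chart g t.
Proof. by move=> cS St; apply: insubdK; apply: chart_salvetti St. Qed.

Lemma chart_cover x : cube_chart (vert x) (cover_val x).2 = cover_val x.
Proof.
rewrite /cube_chart /vert; case E : (cover_val x) => [g t] /=.
have t1 a : (t a == 1) = false.
  by have := cover_coord x a; rewrite E /= => /andP[_ /lt_eqF].
by rewrite (eq_bigl xpred0) ?big_pred0 ?mulg1 //; congr pair; apply/ffunP => a; rewrite ffunE t1.
Qed.

Lemma chart_pt_cover x : chart_pt (vert x) (cover_val x).2 = x.
Proof.
apply: val_inj; rewrite /= -[RHS]chart_cover.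
exact: chart_ptE (cover_clique x) (cover_cube_coord x).
Qed.

Lemma string_chart S g s t : clique e S -> cube_coord S s -> cube_coord S t ->
  cube_string (chart_pt g s) (chart_pt g t) (l1_dist s t).
Proof.
move=> cS Ss St; rewrite -[l1_dist s t]addr0.
apply: (StringCons cS Ss St (chart_ptE g cS Ss) (chart_ptE g cS St)).
exact: StringNil.
Qed.

Definition indic S : {ffun V -> R} := [ffun a => (a \in S)%:R].

Lemma indic_coord S S' : {subset S' <= S} -> cube_coord S (indic S').
Proof.
move=> sS; split=> a; rewrite ffunE; first by case: (_ \in _); rewrite lexx ler01.
by move=> aS; case: (boolP (a \in S')) => // /sS; rewrite (negbTE aS).
Qed.

Definition vertex g : X := chart_pt g [ffun=> 0].

Lemma zero_coord S : cube_coord S ([ffun=> 0] : {ffun V -> R}).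
Proof. by split=> a; rewrite ffunE // lexx ler01. Qed.

Lemma clique0 : clique e pred0.
Proof. exact/cliqueP. Qed.

Lemma clique1 a : clique e (pred1 a).
Proof. by apply/cliqueP => b c /eqP -> /eqP ->; rewrite eqxx. Qed.

Lemma vertexE g : cover_val (vertex g) = (g, [ffun=> 0]).
Proof.
rewrite (chart_ptE g clique0 (zero_coord _)) /cube_chart.
rewrite big_pred0 ?mulg1; last by move=> a; rewrite ffunE eq_sym oner_eq0.
by congr pair; apply/ffunP => a; rewrite !ffunE eq_sym oner_eq0.
Qed.

Lemma chart_indic S g : clique e S ->
  chart_pt g (indic S) = vertex (g * \big[*%g/1%g]_(a | a \in S) raag_gen e a)%g.
Proof.
move=> cS; apply: val_inj; rewrite /= (chart_ptE g cS (@indic_coord S S _)) // vertexE.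
rewrite /cube_chart; congr (_, _).
  congr (_ * _)%g; apply: eq_bigl => a; rewrite ffunE.
  by case: (_ \in _); rewrite ?eqxx // eq_sym oner_eq0.
apply/ffunP => a; rewrite !ffunE.
by case: (_ \in _); rewrite ?eqxx // eq_sym oner_eq0.
Qed.

Lemma vertex1 : vertex 1%g = cover_base R e.
Proof. by apply: val_inj; rewrite /= vertexE. Qed.

Lemma vertex_gen g a : chart_pt g (indic (pred1 a)) = vertex (g * raag_gen e a)%g.
Proof.
rewrite chart_indic ?clique1 //; congr (vertex (_ * _)%g).
by rewrite (eq_bigl (pred1 a)) ?big_pred1_eq.
Qed.

Lemma height_vertex h g : height h (vertex g) = (len (h^-1 * g)%g)%:R.
Proof.
rewrite /height /vert vertexE /= /height0 big1 ?addr0 // => a _.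
by rewrite ffunE mulr0.
Qed.

Lemma vert_vertex g : vert (vertex g) = g.
Proof. by rewrite /vert vertexE. Qed.

Lemma l1_indic1 a : l1_dist [ffun=> 0] (indic (pred1 a)) = 1.
Proof.
rewrite /l1_dist (bigD1 a) //= big1 ?addr0 => [|b ba]; rewrite !ffunE ?inE ?eqxx.
  by rewrite sub0r normrN normr1.
by rewrite (negbTE ba) subrr normr0.
Qed.

Lemma string_edge g (s : V * bool) : cube_string (vertex g) (vertex (g * letter e s)%g) 1.
Proof.
have E h a : cube_string (vertex h) (vertex (h * raag_gen e a)%g) 1.
  rewrite -vertex_gen -(l1_indic1 a); apply: (@string_chart (pred1 a)).
  - exact: clique1.
  - exact: zero_coord.
  - exact: indic_coord.
case: s => a [] /=; first exact: E.
rewrite (letter_linv e (a, true)); apply: cube_string_rev.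
by rewrite -[in X in cube_string _ (vertex X)](mulgVK (letter e (a, true)) g) letter_gen; apply: E.
Qed.

Lemma string_word g w : cube_string (vertex g) (vertex (g * cls e w)%g) (size w)%:R.
Proof.
elim: w g => [|s w IH] g; first by rewrite cls_nil mulg1; apply: StringNil.
rewrite cls_cons mulgA /= -natr1 addrC; apply: cube_string_cat (IH _).
exact: string_edge.
Qed.

Lemma height_base x : height 1%g x = height0 (vert x) (cover_val x).2.
Proof. by rewrite /height invg1 mul1g. Qed.

(** A geodesic from the base first runs to the vertex [k] of the cube of [x] nearest to [e], whose
    coordinates are 1 in the directions [T] of negative slope, and then straight across the cube. *)
Lemma string_base x : cube_string (cover_base R e) x (height 1%g x).
Proof.
set t := (cover_val x).2; set g := vert x.
have cS := cover_clique x; set S := [pred a | _] in cS.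
have St := cover_cube_coord x; rewrite -/t -/S in St.
pose T : {pred V} := [pred a | (a \in S) && (slope g a < 0)].
have TS : {subset T <= S} by move=> a /andP[].
have cT : clique e T.
  by apply/cliqueP => a b /TS aS /TS bS; move/cliqueP: cS; apply.
have s1 := string_chart g cS (indic_coord TS) St.
rewrite chart_pt_cover chart_indic // in s1.
set k := (g * _)%g in s1; have [w kE lk] := len_rep e_sym e_irr k.
have s0 := string_word 1%g w; rewrite -kE mul1g vertex1 -lk in s0.
have -> : height 1%g x = (len k)%:R + l1_dist (indic T) t; last exact: cube_string_cat s0 s1.
rewrite height_base -/g -/t.
have := height_vertex 1%g k; rewrite invg1 mul1g => <-.
have := height_chart 1%g cS (indic_coord TS) (chart_ptE g cS (indic_coord TS)).
rewrite chart_indic // -/k invg1 mul1g => ->.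
rewrite /height0 -addrA -big_split /=; congr (_ + _); apply: eq_bigr => a _.
have t0 := cube_coord_ge0 a St; have t1 : t a <= 1 by case: St => /(_ a)/andP[].
rewrite /indic ffunE inE /= /slope; case: (boolP (a \in S)) => [aS|aS] /=; last first.
  by have -> : t a = 0 by [case: St => _ ->]; rewrite subrr normr0 !mulr0 addr0.
case: ifP => _.
  by rewrite ltrN10 /= ger0_norm ?subr_ge0 // mulr1 mulN1r addrA addNr add0r.
by rewrite ltr10 /= sub0r normrN mulr0 add0r mul1r ger0_norm.
Qed.

Lemma base_dist x : cover_dist (cover_base R e) x = (height 1%g x)%:E.
Proof.
apply/eqP; rewrite eq_le; apply/andP; split.
  by apply: ereal_inf_lbound; exists (height 1%g x) => //; apply: string_base.
apply: le_trans (height_dist 1%g (cover_base R e) x); rewrite lee_fin distrC.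
rewrite -vertex1 height_vertex mulg1 invg1 len1 // subr0; exact: ler_norm.
Qed.

Lemma avoidantE r x : avoidant r x <-> r <= height 1%g x.
Proof. by rewrite /avoidant base_dist lee_fin. Qed.

Lemma sphereE r x : sphere r x <-> height 1%g x = r.
Proof. by rewrite /sphere /= base_dist; split=> [[]|->]. Qed.

End Height.

(** * Avoidant paths *)

Section UnitTopology.
Context (R : realType).
Local Notation I := (unit_itv R).

Lemma unit_itvP (t : I) : 0 <= val t <= 1.
Proof. by have := set_mem (valP t); rewrite /= in_itv. Qed.

Lemma mem_unit_itv (t : R) : 0 <= t <= 1 -> t \in (`[0, 1]%classic : set R).
Proof. by move=> H; apply/mem_set; rewrite /= in_itv. Qed.

Lemma unit_itv_nbhsP (t : I) (U : set I) :
  nbhs t U <-> exists2 d : R, 0 < d & forall s : I, `|val t - val s| < d -> U s.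
Proof.
split.
  case=> [W [[B oB <-] Bt BU]].
  have : nbhs (val t) B by apply: open_nbhs_nbhs.
  move=> /nbhs_ballP[d /= d0 dB]; exists d => // s ts; apply: BU.
  by apply: dB; rewrite /ball.
case=> d d0 dU; have := @initial_continuous _ _ (val : I -> R) t.
move=> /(_ (ball (val t) d) (nbhsx_ballx _ _ d0)) H.
apply: (@filterS _ (nbhs t) _ (val @^-1` ball (val t) d)%classic) H.
by move=> s; apply: dU.
Qed.

End UnitTopology.

Section Paths.
Context (R : realType) (V : finType) (e : rel V).
Hypotheses (e_sym : symmetric e) (e_irr : irreflexive e).
Local Notation A := (raag e).
Local Notation X := (raag_cover R e).
Local Notation I := (unit_itv R).
Local Notation ht := (height 1%g).
Implicit Types (g h : A) (x y z : X) (S : {pred V}) (r d L : R).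

Definition joined x y d : Prop := exists2 c, cube_string x y c & c <= d.

Lemma joinedxx x d : 0 <= d -> joined x x d.
Proof. by move=> d0; exists 0 => //; apply: StringNil. Qed.

Lemma joined_trans x y z c d : joined x y c -> joined y z d -> joined x z (c + d).
Proof.
move=> [a xa ac] [b yb bd]; exists (a + b); last exact: lerD.
exact: cube_string_cat xa yb.
Qed.

Lemma joined_sym x y d : joined x y d -> joined y x d.
Proof. by move=> [a xa ad]; exists a => //; apply: cube_string_rev. Qed.

Lemma joined_dist x y d : joined x y d -> (cover_dist x y <= d%:E)%E.
Proof.
move=> [c xc cd]; apply: (@le_trans _ _ c%:E); last by rewrite lee_fin.
by apply: ereal_inf_lbound; exists c.
Qed.

(* Lipschitz paths on [0, L] concatenate without reparametrization. *)
Definition reach r x y L : Prop := exists f : R -> X,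
  [/\ 0 <= L, f 0 = x, f L = y,
      forall s t, 0 <= s -> s <= t -> t <= L -> joined (f s) (f t) (t - s) &
      forall t, 0 <= t -> t <= L -> r <= ht (f t)].

Lemma reach_cst r x d : 0 <= d -> r <= ht x -> reach r x x d.
Proof.
move=> d0 rx; exists (fun=> x); split=> // s t _ st _.
by apply: joinedxx; rewrite subr_ge0.
Qed.

Lemma reach_trans r x y z L M : reach r x y L -> reach r y z M -> reach r x z (L + M).
Proof.
move=> [f [L0 f0 fL fl fr]] [g [M0 g0 gM gl gr]].
exists (fun t => if t <= L then f t else g (t - L)); split.
- exact: addr_ge0.
- by rewrite L0.
- case: ifPn => [LM|_]; last by rewrite addrAC subrr add0r.
  have M00 : M = 0 by apply/eqP; rewrite eq_le M0 andbT -(lerD2l L) addr0.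
  by rewrite M00 addr0 fL -gM M00 g0.
- move=> s t s0 st tLM; case: ifPn => sL; case: ifPn => tL.
  + exact: fl.
  + rewrite -ltNge in tL.
    have -> : t - s = (L - s) + (t - L - 0) by ring.
    apply: (@joined_trans _ y); first by rewrite -fL; apply: fl.
    by rewrite -g0; apply: gl => //; lra.
  + by rewrite (le_trans st tL) in sL.
  + rewrite -!ltNge in sL tL.
    have -> : t - s = (t - L) - (s - L) by ring.
    by apply: gl; rewrite ?subr_ge0 ?(ltW sL) ?lerB // lerBlDl.
- move=> t t0 tLM; case: ifPn => tL; first exact: fr.
  by rewrite -ltNge in tL; apply: gr; rewrite ?subr_ge0 ?(ltW tL) // lerBlDl.
Qed.

Lemma reach_sym r x y L : reach r x y L -> reach r y x L.
Proof.
move=> [f [L0 f0 fL fl fr]]; exists (fun t => f (L - t)); split=> //.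
- by rewrite subr0.
- by rewrite subrr.
- move=> s t s0 st tL; apply: joined_sym.
  have -> : t - s = (L - s) - (L - t) by ring.
  by apply: fl; rewrite ?subr_ge0 ?lerB // lerBlDr lerDl.
- by move=> t t0 tL; apply: fr; rewrite ?subr_ge0 // lerBlDr lerDl.
Qed.

Lemma reach_weak r r' x y L L' : r' <= r -> L <= L' -> reach r x y L -> reach r' x y L'.
Proof.
move=> rr LL H; have : reach r x y (L + (L' - L)).
  apply: reach_trans (H) _; apply: reach_cst; first by rewrite subr_ge0.
  by case: H => f [L0 _ <- _]; apply.
rewrite addrC subrK => -[f [L0 f0 fL fl fr]]; exists f; split=> // t t0 tL.
exact: le_trans (fr t t0 tL).
Qed.

(** The height is affine on a cube, so on a segment it is at least its smaller end value. *)
Lemma reach_segment S g (s t : {ffun V -> R}) r : clique e S -> cube_coord S s ->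
  cube_coord S t -> r <= ht (chart_pt g s) -> r <= ht (chart_pt g t) ->
  reach r (chart_pt g s) (chart_pt g t) (l1_dist s t).
Proof.
move=> cS Ss St rs rt; have d0 : 0 <= l1_dist s t by apply: sumr_ge0.
have [d00|dn0] := eqVneq (l1_dist s t) 0.
  have -> : t = s.
    apply/ffunP => a; apply/eqP; rewrite -subr_eq0 -normr_eq0 distrC.
    by move/eqP: d00; rewrite psumr_eq0 // => /allP /(_ a (mem_index_enum _)).
  by apply: reach_cst => //; apply: sumr_ge0.
have dp : 0 < l1_dist s t by rewrite lt_def dn0.
set d := l1_dist s t in d0 dn0 dp *.
pose u (c : R) : {ffun V -> R} := [ffun a => s a + (c / d) * (t a - s a)].
have Su c : 0 <= c -> c <= d -> cube_coord S (u c).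
  move=> c0 cd; have l0 : 0 <= c / d by apply: divr_ge0.
  have l1 : c / d <= 1 by rewrite ler_pdivrMr // mul1r.
  split=> a; rewrite ffunE.
    case: Ss => /(_ a)/andP[? ?] _; case: St => /(_ a)/andP[? ?] _.
    by apply/andP; split; nra.
  by move=> aS; case: Ss => _ ->; rewrite // add0r subr0; case: St => _ ->; rewrite ?mulr0.
have u0 : u 0 = s by apply/ffunP => a; rewrite ffunE mul0r mul0r addr0.
have ud : u d = t by apply/ffunP => a; rewrite ffunE divff // mul1r addrC subrK.
exists (fun c => chart_pt g (u c)); rewrite u0 ud; split=> //.
  move=> c c' c0 cc' c'd.
  have -> : c' - c = l1_dist (u c) (u c').
    have -> : c' - c = (c' - c) / d * d by rewrite divfK.
    rewrite {2}/d /l1_dist mulr_sumr; apply: eq_bigr => a _.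
    rewrite !ffunE -[X in X * _]ger0_norm -?normrM; last by rewrite divr_ge0 ?subr_ge0.
    rewrite distrC -normrN; congr (`|_|); ring.
  exists (l1_dist (u c) (u c')) => //; apply: (@string_chart _ _ _ S) => //.
    by apply: Su => //; apply: le_trans c'd.
  by apply: Su => //; apply: le_trans cc'.
move=> c c0 cd; have cu := Su c c0 cd.
move: rs rt; rewrite !(height_chart e_sym e_irr 1%g cS _ (chart_ptE g cS _)) //.
set h := (_ * _)%g => rs rt; have l0 : 0 <= c / d by apply: divr_ge0.
have l1 : c / d <= 1 by rewrite ler_pdivrMr // mul1r.
have -> : height0 h (u c) = (1 - c / d) * height0 h s + c / d * height0 h t.
  rewrite /height0; set N := (len h)%:R.
  rewrite !mulrDr !mulr_sumr addrACA -mulrDl subrK mul1r; congr (_ + _).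
  rewrite -big_split /=; apply: eq_bigr => a _; rewrite ffunE; ring.
nra.
Qed.

Lemma reach_edge n g (s : V * bool) : (n <= len g)%N -> (n <= len (g * letter e s)%g)%N ->
  reach n%:R (vertex R g) (vertex R (g * letter e s)%g) 1.
Proof.
move=> ng ngs.
have E h a : (n <= len h)%N -> (n <= len (h * raag_gen e a)%g)%N ->
    reach n%:R (vertex R h) (vertex R (h * raag_gen e a)%g) 1.
  move=> nh nha; rewrite -vertex_gen // -[X in reach _ _ _ X](l1_indic1 R a).
  apply: (@reach_segment (pred1 a)).
  - exact: clique1.
  - exact: zero_coord.
  - exact: indic_coord.
  - by rewrite -/(vertex R h) height_vertex // invg1 mul1g ler_nat.
  - by rewrite vertex_gen // height_vertex // invg1 mul1g ler_nat.
case: s ngs => a [] /= ngs; first exact: E.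
rewrite (letter_linv e (a, true)) in ngs *; apply: reach_sym.
rewrite -[in X in reach _ _ (vertex _ X) _](mulgVK (letter e (a, true)) g) letter_gen.
by apply: E; rewrite // -letter_gen mulgVK.
Qed.

Fixpoint above (n : nat) g (w : word V) : bool :=
  (n <= len g)%N && (if w is s :: v then above n (g * letter e s)%g v else true).

Lemma reach_word n g w : above n g w ->
  reach n%:R (vertex R g) (vertex R (g * cls e w)%g) (size w)%:R.
Proof.
elim: w g => [|s w IH] g /= /andP[ng aw].
  by rewrite cls_nil mulg1; apply: reach_cst => //; rewrite height_vertex // invg1 mul1g ler_nat.
rewrite cls_cons mulgA -natr1 addrC; apply: reach_trans (IH _ aw).
by apply: reach_edge => //; case: w aw {IH} => [|? ?] /= /andP[].
Qed.

Lemma aboveP n g w : (forall k, (k <= size w)%N -> (n <= len (g * cls e (take k w))%g)%N) ->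
  above n g w.
Proof.
elim: w g => [|s w IH] g H /=; first by have := H 0%N; rewrite cls_nil mulg1 andbT; apply.
apply/andP; split; first by have := H 0%N; rewrite take0 cls_nil mulg1; apply.
apply: IH => k kw; have := H k.+1; rewrite ltnS => /(_ kw) /=.
by rewrite cls_cons mulgA.
Qed.

(** Moving every coordinate towards its end farther from [e] leads to a vertex of the cube without
    ever coming closer to [e]. *)
Lemma reach_outward x : exists g, [/\ reach (ht x) x (vertex R g) #|V|%:R,
  ht x <= (len g)%:R & (len g)%:R <= ht x + #|V|%:R].
Proof.
have cS := cover_clique x; set S := [pred a | _] in cS.
have St := cover_cube_coord x; set t := (cover_val x).2 in S cS St.
rewrite -/S in St.
pose T : {pred V} := [pred a | (a \in S) && (0 < slope R (vert x) a)].
have TS : {subset T <= S} by move=> a /andP[].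
have cT : clique e T.
  by apply/cliqueP => a b /TS aS /TS bS; move/cliqueP: cS; apply.
have ST := indic_coord R TS.
set g := (vert x * \big[*%g/1%g]_(a | a \in T) raag_gen e a)%g.
have gE : chart_pt (vert x) (indic R T) = vertex R g by rewrite chart_indic.
have hx : ht x = height0 (vert x) t by rewrite height_base.
have hg : (len g)%:R = height0 (vert x) (indic R T) :> R.
  have := height_chart e_sym e_irr 1%g cS ST (chart_ptE (vert x) cS ST).
  by rewrite gE height_vertex // invg1 !mul1g.
have l1V : l1_dist t (indic R T) <= #|V|%:R.
  rewrite -sumr_const; apply: ler_sum => a _.
  case: St => /(_ a)/andP[? ?] _; case: ST => /(_ a)/andP[? ?] _.
  by rewrite ler_norml; apply/andP; split; lra.
have up : ht x <= (len g)%:R.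
  rewrite hx hg /height0 lerD2l; apply: ler_sum => a _.
  have t0 := cube_coord_ge0 a St; have t1 : t a <= 1 by case: St => /(_ a)/andP[].
  rewrite /indic ffunE inE /= /slope; case: (boolP (a \in S)) => [aS|aS] /=; last first.
    by have -> : t a = 0 by [case: St => _ ->]; rewrite mulr0.
  have n10 : (0 < -1 :> R) = false by apply/negbTE; rewrite -leNgt lerN10.
  by case: ifP => _; rewrite ?ltr01 ?n10 /= ?mulr0n ?mulr1n ?mulr0 ?mulr1 ?mul1r ?mulN1r ?oppr_le0.
exists g; split=> //.
  apply: (reach_weak (lexx _) l1V); rewrite -gE -[X in reach _ X](chart_pt_cover x).
  apply: reach_segment cS St ST _ _; first by rewrite chart_pt_cover.
  by rewrite gE height_vertex // invg1 mul1g.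
rewrite hx hg addrC -lerBlDr; apply: le_trans (ler_norm _) _.
by apply: le_trans (height0_lip _ _ _) _; rewrite l1_distC.
Qed.

Lemma joined_ball x y d : joined x y d -> forall c, d < c -> ball x c y.
Proof.
move=> [b xb bd] c dc; apply/cover_dist_ltP; exists b => //; exact: le_lt_trans dc.
Qed.

Section ReachPath.
Variables (r : R) (x y : X) (L : R) (f : R -> X).
Hypotheses (L0 : 0 <= L) (f0 : f 0 = x) (fL : f L = y)
  (fl : forall s t, 0 <= s -> s <= t -> t <= L -> joined (f s) (f t) (t - s))
  (fr : forall t, 0 <= t -> t <= L -> r <= ht (f t)).

Definition reach_fun (t : I) : X := f (L * val t).

Lemma reach_fun_joined (s t : I) : val s <= val t ->
  joined (reach_fun s) (reach_fun t) (L * (val t - val s)).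
Proof.
move=> st; rewrite mulrBr; have /andP[s0 _] := unit_itvP s; have /andP[_ t1] := unit_itvP t.
by apply: fl; rewrite ?mulr_ge0 ?ler_wpM2l // ler_piMr.
Qed.

Lemma reach_fun_continuous : continuous reach_fun.
Proof.
move=> t U /nbhs_ballP[d /= d0 dU]; apply/unit_itv_nbhsP.
(* The denominator is [L + 1] because [L] may be 0. *)
exists (d / (L + 1)); first by rewrite divr_gt0 // ltr_wpDl.
move=> s ts; apply: dU.
have lt : L * `|val t - val s| < d.
  apply: le_lt_trans (_ : (L + 1) * `|val t - val s| < d).
    by rewrite ler_wpM2r // lerDl.
  by rewrite mulrC -ltr_pdivlMr // ltr_wpDl.
have [st|/ltW st] := leP (val t) (val s).
  apply: (joined_ball (reach_fun_joined st)); move: lt.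
  by rewrite distrC ger0_norm // subr_ge0.
apply: (joined_ball (joined_sym (reach_fun_joined st))); move: lt.
by rewrite ger0_norm // subr_ge0.
Qed.

Lemma reach_fun0 : reach_fun zero = x.
Proof. by rewrite /reach_fun /= mulr0 f0. Qed.

Lemma reach_fun1 : reach_fun one = y.
Proof. by rewrite /reach_fun /= mulr1 fL. Qed.

Lemma reach_fun_avoid t : r <= ht (reach_fun t).
Proof.
have /andP[t0 t1] := unit_itvP t.
by apply: fr; rewrite ?mulr_ge0 // ler_piMr.
Qed.

Lemma reach_fun_length : (path_length reach_fun <= L%:E)%E.
Proof.
apply: ge_ereal_sup => _ [u /= su <-].
case: u su => [|a u] su; first by rewrite big_nil lee_fin.
apply: (@le_trans _ _ (L * (val (last a u) - val a))%:E); last first.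
  rewrite lee_fin; have /andP[a0 _] := unit_itvP a.
  by have /andP[_ l1] := unit_itvP (last a u); rewrite ler_piMr // lerBlDr (le_trans l1) // lerDl.
elim: u a su => [|b u IH] a /=; first by rewrite big_nil subrr mulr0.
move=> /andP[ab su]; rewrite big_cons /=.
have -> : L * (val (last b u) - val a) = L * (val b - val a) + L * (val (last b u) - val b).
  by rewrite -mulrDr; congr (_ * _); ring.
rewrite EFinD; apply: leeD; last exact: IH.
exact: joined_dist (reach_fun_joined ab).
Qed.

End ReachPath.

Lemma reach_path r x y L : reach r x y L ->
  exists P : {path I from x to y},
    (forall t, avoidant r (P t)) /\ (path_length P <= L%:E)%E.
Proof.
move=> [f [L0 f0 fL fl fr]].
exists (@mk_path _ _ x y _ (reach_fun_continuous L0 fl) (reach_fun0 L f0) (reach_fun1 fL)).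
split; last exact: reach_fun_length.
by move=> t; apply/avoidantE => //; apply: reach_fun_avoid.
Qed.

Lemma reach_avoidant_dist r x y L : reach r x y L -> (avoidant_dist r x y <= L%:E)%E.
Proof.
move=> /reach_path[P [Pr PL]]; apply: le_trans PL.
by apply: ereal_inf_lbound; exists P.
Qed.

End Paths.

(** * Upper bounds *)

Section Cones.
Context (R : realType) (V : finType) (e : rel V).
Hypotheses (e_sym : symmetric e) (e_irr : irreflexive e).
Local Notation A := (raag e).
Implicit Types (g h : A) (s t : V * bool) (a b c : V) (w u v : word V).

Lemma cls_nseq k s : cls e (nseq k s) = (letter e s ^+ k)%g.
Proof. by elim: k => [|k IH]; rewrite ?expg0 // expgS /= cls_cons IH. Qed.

Lemma reduced_no_inverse w : (forall s, s \in w -> linv s \notin w) -> reduced e w.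
Proof.
elim: w => [|s w IH] //= H; apply/andP; split.
  apply/negP => /(initial_mem e_irr) i; have := H s (mem_head _ _).
  by rewrite inE i orbT.
apply: IH => t tw; have := H t; rewrite inE tw orbT => /(_ isT).
by rewrite inE negb_or => /andP[].
Qed.

Lemma len_powers k l s t : s.1 != t.1 -> len (letter e s ^+ k * letter e t ^+ l)%g = (k + l)%N.
Proof.
move=> st; rewrite -!cls_nseq -cls_cat len_reduced ?size_cat ?size_nseq //.
apply: reduced_no_inverse => x; rewrite !mem_cat !mem_nseq.
have ne (y z : V * bool) : y.1 != z.1 -> (linv y == z) = false.
  by move=> yz; apply/negP => /eqP E; move: yz; rewrite -E /= eqxx.
by case/orP => /andP[_ /eqP ->]; rewrite (negbTE (linv_neq _)) ne ?andbF // eq_sym.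
Qed.

Lemma len_power k s : len (letter e s ^+ k)%g = k.
Proof.
rewrite -cls_nseq len_reduced ?size_nseq //; apply: reduced_no_inverse => x.
by rewrite !mem_nseq => /andP[_ /eqP ->]; rewrite (negbTE (linv_neq _)) andbF.
Qed.

Lemma len_Mr g h : (len h <= len g + len (g * h)%g)%N.
Proof. by rewrite -{1}(mulKg g h) -(lenV e_sym e_irr g); apply: lenM. Qed.

(** At most one of [b] and its inverse is initial in [g^-1], so the other can be appended without
    cancellation. It then ends the product, so its inverse does not, and the step repeats. *)
Lemma exists_outward g b : exists s : bool, forall k : nat,
  len (g * letter e (b, s) ^+ k)%g = (len g + k)%N.
Proof.
have [s is_] : exists s : bool, ~~ ini g^-1%g (b, s).
  case: (boolP (ini g^-1%g (b, true))) => [i|i]; last by exists true.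
  by exists false; apply: (ini_neq_linv e_sym e_irr i).
exists s => k.
suff [] : len (g * letter e (b, s) ^+ k)%g = (len g + k)%N /\
          ~~ ini (g * letter e (b, s) ^+ k)^-1%g (b, s) by [].
elim: k => [|k [IH1 IH2]]; first by rewrite expg0 mulg1 addn0.
rewrite expgSr mulgA; split.
  by rewrite len_Mletter // (negbTE IH2) IH1 addnS.
rewrite invgM -letter_linv; apply/negP => i.
have : ini (letter e (linv (b, s)) * (g * letter e (b, s) ^+ k)^-1)%g (linv (b, s)).
  by rewrite ini_letterM // linvK.
by move/(ini_neq_linv e_sym e_irr); rewrite linvK i.
Qed.

Section Level.
Variable n : nat.

Definition vreach g h (k : nat) : Prop := reach n%:R (vertex R g) (vertex R h) k%:R.

Lemma vreach_trans g h h' k l : vreach g h k -> vreach h h' l -> vreach g h' (k + l).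
Proof. by rewrite /vreach natrD; apply: reach_trans. Qed.

Lemma vreach_sym g h k : vreach g h k -> vreach h g k.
Proof. exact: reach_sym. Qed.

Lemma vreach_weak g h k l : (k <= l)%N -> vreach g h k -> vreach g h l.
Proof. by move=> kl; apply: reach_weak => //; rewrite ler_nat. Qed.

Lemma vreach_word g w : (forall k, (n <= len (g * cls e (take k w))%g)%N) ->
  vreach g (g * cls e w)%g (size w).
Proof. by move=> H; apply: reach_word => //; apply: aboveP. Qed.

Lemma vreach_power g s N : (forall k, (n <= len (g * letter e s ^+ k)%g)%N) ->
  vreach g (g * letter e s ^+ N)%g N.
Proof.
move=> H; rewrite -cls_nseq -{2}(size_nseq N s); apply: vreach_word => k.
have [kN|kN] := leqP k N; first by rewrite take_nseq // cls_nseq.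
by rewrite take_oversize ?size_nseq ?cls_nseq // ltnW.
Qed.

Section Quadratic.
Hypotheses (conn : forall a b, connect e a b) (V_gt1 : (1 < #|V|)%N).
Variable N : nat.

(** Within the flat of [b] and [c] at [h], the power of [c] is appended first and that of [b]
    removed afterwards. All points on the way are [h] times an element of length at least [N], hence
    of length at least [N - len h >= n]. *)
Lemma vreach_switch h b c (s s' : bool) : (len h + n <= N)%N -> e b c ->
  vreach (h * letter e (b, s) ^+ N)%g (h * letter e (c, s') ^+ N)%g (N + N).
Proof.
move=> hN ebc; have bc : b != c by apply: contraTneq ebc => ->; rewrite e_irr.
have C : commute (letter e (b, s) ^+ N)%g (letter e (c, s') ^+ N)%g.
  by apply/commuteX/commute_sym/commuteX/letterC => //=; rewrite e_sym.
have L x y k : x.1 != y.1 -> (n <= len (h * letter e x ^+ N * letter e y ^+ k)%g)%N.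
  move=> xy; have := len_Mr h (letter e x ^+ N * letter e y ^+ k)%g.
  by rewrite len_powers // mulgA; set z := len (_ * _ * _)%g; lia.
apply: (@vreach_trans _ (h * letter e (b, s) ^+ N * letter e (c, s') ^+ N)%g).
  by apply: vreach_power => k; apply: L.
rewrite -mulgA C mulgA; apply: vreach_sym.
by apply: vreach_power => k; apply: L; rewrite eq_sym.
Qed.

Lemma vreach_switch_path h b p (s : bool) : (len h + n <= N)%N -> path e b p ->
  vreach (h * letter e (b, s) ^+ N)%g (h * letter e (last b p, s) ^+ N)%g (size p * (N + N)).
Proof.
move=> hN; elim: p b => [|c p IH] b /=.
  move=> _; apply: reach_cst => //; rewrite height_vertex // invg1 mul1g ler_nat.
  have := len_Mr h (letter e (b, s) ^+ N)%g; rewrite len_power; lia.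
move=> /andP[ebc pp]; rewrite mulSn; apply: vreach_trans (IH _ pp).
exact: vreach_switch.
Qed.

Definition switch_cost : nat := (#|V| + 2) * (N + N).

(** A simple path from [b] to [c] preserves the sign [s]; a detour through a neighbour [d] of [c]
    then changes it to [s']. This takes at most [#|V| + 2] exchanges. *)
Lemma vreach_switch_any h b c (s s' : bool) : (len h + n <= N)%N ->
  vreach (h * letter e (b, s) ^+ N)%g (h * letter e (c, s') ^+ N)%g switch_cost.
Proof.
move=> hN; have /connectP[p pp lp] := conn b c.
have [q [qq lq sq]] : exists q, [/\ path e b q, c = last b q & (size q <= #|V|)%N].
  case/shortenP: pp lp => q pq uq _ lq; exists q; split=> //.
  have := max_card (mem (b :: q)); rewrite (card_uniqP uq) /=; exact: ltnW.
have [d ecd] : exists d, e c d.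
  have [d dc] : exists d, d != c.
    have /card_gt0P[d] : (0 < #|predC1 c|)%N by rewrite cardC1 -ltnS prednK // ltnW.
    by rewrite inE => dc; exists d.
  have /connectP[[|d' q'] /= pq ld] := conn c d; first by rewrite ld eqxx in dc.
  by case/andP: pq => ecd _; exists d'.
rewrite /switch_cost mulnDl mul2n -addnn.
apply: (@vreach_trans _ (h * letter e (c, s) ^+ N)%g).
  apply: (vreach_weak (leq_mul sq (leqnn _))); rewrite lq.
  exact: vreach_switch_path.
apply: (@vreach_trans _ (h * letter e (d, s) ^+ N)%g); first exact: vreach_switch.
by apply: vreach_switch => //; rewrite e_sym.
Qed.

(** The last letter [t] of the word is dropped by first exchanging [b] for [t.1]: powers of [t.1]
    commute with [t], so a single edge then removes it. *)
Lemma vreach_descend w b b0 (s : bool) : (size w + n <= N)%N ->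
  vreach (cls e w * letter e (b, s) ^+ N)%g (letter e (b0, true) ^+ N)%g
    (size w * switch_cost.+1 + switch_cost).
Proof.
elim/last_ind: w b s => [|w t IH] b s wN.
  rewrite mul0n add0n cls_nil -[X in vreach _ X](mul1g (letter e (b0, true) ^+ N)%g).
  by apply: vreach_switch_any; rewrite len1.
have lw u : (len (cls e u) <= size u)%N by apply: len_cls.
rewrite size_rcons in wN *.
have -> : ((size w).+1 * switch_cost.+1 + switch_cost =
    switch_cost + (1 + (size w * switch_cost.+1 + switch_cost)))%N by lia.
have ht : (len (cls e (rcons w t)) + n <= N)%N.
  by have := lw (rcons w t); rewrite size_rcons; set z := len _; lia.
apply: vreach_trans (vreach_switch_any b t.1 s true ht) _.
apply: vreach_trans (IH t.1 true _); last by lia.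
have C : commute (letter e t) (letter e (t.1, true) ^+ N)%g.
  apply: commuteX; case: (t) => a [] /=; first exact: commute_refl.
  by rewrite (letter_linv e (a, true)); apply/commute_sym/commuteV.
have E : (cls e (rcons w t) * letter e (t.1, true) ^+ N =
          cls e w * letter e (t.1, true) ^+ N * letter e t)%g.
  by rewrite -cats1 cls_cat -[cls e [:: t]]/(letter e t) -!mulgA C.
rewrite E; apply/vreach_sym/reach_edge => //.
  by have := len_Mr (cls e w) (letter e (t.1, true) ^+ N)%g; rewrite len_power; have := lw w; lia.
by rewrite -E; have := len_Mr (cls e (rcons w t)) (letter e (t.1, true) ^+ N)%g; rewrite len_power; lia.
Qed.

Lemma vreach_cone g b0 : (n <= len g)%N -> (len g + n <= N)%N ->
  vreach g (letter e (b0, true) ^+ N)%g (N + (len g * switch_cost.+1 + switch_cost)).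
Proof.
move=> ng gN; have [s Hs] := exists_outward g b0.
apply: (@vreach_trans _ (g * letter e (b0, s) ^+ N)%g).
  by apply: vreach_power => k; rewrite Hs; lia.
have [w gE lw] := len_rep e_sym e_irr g; rewrite lw {1}gE; apply: vreach_descend.
by rewrite -lw.
Qed.

End Quadratic.

Section Linear.
Variable P : pred V.
Hypothesis P_join : forall a b, P a -> ~~ P b -> e a b.
Variables (a0 b0 : V).
Hypotheses (Pa0 : P a0) (Pb0 : ~~ P b0).

Local Notation inP := (all (fun s : V * bool => P s.1)).
Local Notation outP := (all (fun s : V * bool => ~~ P s.1)).

Lemma commute_cross u v : inP u -> outP v -> commute (cls e u) (cls e v).
Proof.
elim: u => [|s u IH] /=; first by move=> _ _; apply/commute_sym/commute1.
move=> /andP[Ps Pu] Pv; rewrite cls_cons; apply/commute_sym/commuteM; apply/commute_sym.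
  elim: v Pv {IH} => [|t v IH] /=; first by move=> _; apply: commute1.
  move=> /andP[Pt Pv]; rewrite cls_cons; apply: commuteM (IH Pv).
  by apply: letterC => //; apply: P_join.
exact: IH.
Qed.

Lemma nf_subset w : {subset nf e w <= w}.
Proof.
elim: w => //= s w IH t; rewrite /lmul; case: ifP => _.
  by move=> /mem_rem /IH tw; rewrite inE tw orbT.
by rewrite !inE => /predU1P[->|/IH ->]; rewrite ?eqxx ?orbT.
Qed.

Lemma ini_mem w s : ini (cls e w) s -> s \in w.
Proof.
rewrite /ini (shuffle_initial s (shuffle_repr e_sym e_irr w)).
by move=> /(initial_mem e_irr) /nf_subset.
Qed.

Lemma len_cross u v : inP u -> outP v ->
  len (cls e u * cls e v)%g = (len (cls e u) + len (cls e v))%N.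
Proof.
move=> Pu Pv; rewrite -{1}(invgK (cls e u)) len_no_cancel // ?lenV // => s.
rewrite -cls_inv => /ini_mem su /ini_mem sv.
have := allP Pv _ sv; move: su; rewrite /inv_word mem_rev => /mapP[t tu ->] /=.
by rewrite (allP Pu _ tu).
Qed.

Lemma cls_split w :
  cls e w = (cls e [seq s <- w | P s.1] * cls e [seq s <- w | ~~ P s.1])%g.
Proof.
elim: w => [|s w IH] /=; first by rewrite mulg1.
rewrite cls_cons {}IH; case: (boolP (P s.1)) => Ps /=; first by rewrite cls_cons mulgA.
rewrite cls_cons !mulgA; congr (_ * _)%g; apply/commute_sym.
rewrite -[letter e s]/(cls e [:: s]); apply: commute_cross; first exact: filter_all.
by rewrite /= Ps.
Qed.

(** With [u] and [v] the parts of [g] in the two factors, the route appends a power of [b0], drops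
    [u], appends a power of [a0], and drops the rest. Lengths add across the join, and after the
    first stage a part of length at least [n] is always kept entire. *)
Lemma vreach_join_cone g N : (n <= len g)%N -> (len g + n <= N)%N ->
  vreach g (letter e (a0, true) ^+ N)%g (3 * N + 2 * len g).
Proof.
move=> ng gN; have [w gE lw] := len_rep e_sym e_irr g.
pose u := [seq s <- w | P s.1]; pose v := [seq s <- w | ~~ P s.1].
have uP : inP u by apply: filter_all.
have vP : outP v by apply: filter_all.
have szw : (size u + size v = len g)%N by rewrite lw !size_filter count_predC.
have [s Hs] := exists_outward g b0; pose bN := nseq N (b0, s).
have vbP : outP (v ++ bN) by rewrite all_cat vP all_nseq Pb0 orbT.
have E : (g * letter e (b0, s) ^+ N = cls e (v ++ bN) * cls e u)%g.
  rewrite gE cls_split -/u -/v -cls_nseq -/bN -mulgA -(cls_cat e v bN).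
  exact: commute_cross.
have Lvb : (n <= len (cls e (v ++ bN)))%N.
  have := len_Mr (cls e v) (cls e bN); rewrite -cls_cat {1}/bN cls_nseq len_power.
  have := len_cls e_sym e_irr v; lia.
have T (x : pred (V * bool)) k z : all x z -> all x (take k z).
  by move=> /allP H; apply/allP => y /mem_take; apply: H.
(* The final [size u + size v] is slack; the other summands are the costs of the four stages. *)
have -> : (3 * N + 2 * len g = N + (size u + (N + (size (v ++ bN) + (size u + size v)))))%N.
  rewrite size_cat size_nseq -szw; set k := size u; set l := size v; lia.
apply: (@vreach_trans _ (g * letter e (b0, s) ^+ N)%g).
  by apply: vreach_power => k; rewrite Hs; lia.
rewrite E; apply: (@vreach_trans _ (cls e (v ++ bN))).
  apply/vreach_sym/vreach_word => k.
  rewrite -(commute_cross (T _ k _ uP) vbP) len_cross ?T //; lia.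
have aP k : inP (nseq k (a0, true)) by rewrite all_nseq Pa0 orbT.
apply: (@vreach_trans _ (cls e (v ++ bN) * letter e (a0, true) ^+ N)%g).
  apply: vreach_power => k; rewrite -cls_nseq -(commute_cross (aP k) vbP) len_cross //; lia.
apply: (vreach_weak (leq_addr _ _)).
rewrite -cls_nseq -(commute_cross (aP N) vbP); apply/vreach_sym/vreach_word => k.
rewrite len_cross ?T // cls_nseq len_power; lia.
Qed.

End Linear.

End Level.

(* The apex c depends on M only, so that any two vertices can be joined through it. *)
Definition cone_cost (cost : nat -> nat) : Prop := forall M, exists c : A,
  forall n g, (n <= len g)%N -> (len g <= M)%N -> vreach n g c (cost M).

Lemma cone_cost_connected : (forall a b, connect e a b) -> (1 < #|V|)%N ->
  cone_cost (fun M => 20 * (#|V| + 2) * (M.+1 * M.+1))%N.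
Proof.
move=> conn V1 M; have /card_gt0P[b0 _] : (0 < #|V|)%N by apply: ltnW.
(* The apex must not depend on [n]; the exponent [M + M] bounds [len g + n] for all
   [n <= len g <= M]. *)
exists (letter e (b0, true) ^+ (M + M))%g => n g ng gM.
have gN : (len g + n <= M + M)%N by lia.
apply: vreach_weak (vreach_cone conn V1 b0 ng gN).
apply: (@leq_trans (M + M + (M * (switch_cost (M + M)).+1 + switch_cost (M + M)))%N).
  by rewrite !leq_add2l leq_add2r leq_mul2r gM orbT.
rewrite /switch_cost; set v := (#|V| + 2)%N; have : (2 <= v)%N by rewrite leq_addl.
nia.
Qed.

Lemma cone_cost_join (P : pred V) (a0 b0 : V) : P a0 -> ~~ P b0 ->
  (forall a b, P a -> ~~ P b -> e a b) -> cone_cost (fun M => 8 * M)%N.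
Proof.
move=> Pa Pb Pj M; exists (letter e (a0, true) ^+ (M + M))%g => n g ng gM.
have gN : (len g + n <= M + M)%N by lia.
apply: vreach_weak (vreach_join_cone Pj Pa Pb ng gN); lia.
Qed.

End Cones.

(** * Formal chains and their degree *)

Section Chains.
Context (K : choiceType).
Implicit Types (x y z : K) (D : {freeg K / int}).

Lemma additive_sum (U W : zmodType) (F : U -> W) (J : Type) (s : seq J) (G : J -> U) :
  (forall u v, F (u - v) = F u - F v) -> F (\sum_(i <- s) G i) = \sum_(i <- s) F (G i).
Proof.
move=> FB; have F0 : F 0 = 0 by rewrite -(subrr 0) FB subrr.
have FD u v : F (u + v) = F u + F v by rewrite -{1}(opprK v) FB -(sub0r v) FB F0 sub0r opprK.
by elim: s => [|i s IH]; rewrite ?big_nil // !big_cons FD IH.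
Qed.

Lemma fglift_sum (W : lmodType int) (K' : choiceType) (f : K' -> W) (J : Type) (s : seq J)
    (G : J -> {freeg K' / int}) :
  fglift f (\sum_(i <- s) G i) = \sum_(i <- s) fglift f (G i).
Proof. by apply: additive_sum => u v; apply: lift_is_additive. Qed.

Lemma freegZ (k : int) x : k *: << x >> = << k *g x >> :> {freeg K / int}.
Proof. by apply/eqP/freeg_eqP => y; rewrite coeffZ !coeffU mul1r. Qed.

Lemma freegU_sum (J : Type) (s : seq J) (k : J -> int) x :
  \sum_(i <- s) << k i *g x >> = << \sum_(i <- s) k i *g x >> :> {freeg K / int}.
Proof.
elim: s => [|i s IH]; first by rewrite !big_nil freegU0.
by rewrite !big_cons IH freegUD.
Qed.

Lemma deg_coeff D : deg D = \sum_(x <- dom D) coeff x D.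
Proof.
rewrite -{1}(freeg_sumE D) /deg fglift_sum; apply: eq_bigr => x _.
by rewrite liftU /GRing.scale /= mulr1.
Qed.

End Chains.

(** * Acyclicity at infinity and the upper bound for [div0] *)

Section Acyclic.
Context (R : realType) (V : finType) (e : rel V).
Hypotheses (e_sym : symmetric e) (e_irr : irreflexive e).
Local Notation A := (raag e).
Local Notation X := (raag_cover R e).
Local Notation I := (unit_itv R).
Local Notation ht := (height 1%g).
Implicit Types (x y : X) (r rho : R).

(** The summand [#|V|] leaves room for the height gained in [reach_outward]. *)
Definition floor_bound r : nat := (Num.truncn (r + #|V|%:R)).+1.

Lemma floor_boundP r : r + #|V|%:R <= (floor_bound r)%:R.
Proof. by apply/ltW; apply: truncnS_gt. Qed.

Lemma floor_bound_le r : 0 <= r -> (floor_bound r)%:R <= r + #|V|%:R + 1.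
Proof.
by move=> r0; rewrite -natr1 lerD2r truncn_le // addr_ge0.
Qed.

(** Both points are pushed out to vertices, which are joined through the apex. The integer level [n]
    is the smaller of the two lengths, so it is at least [r]. *)
Lemma cone_reach cost x y r M : cone_cost R e cost -> r <= ht x -> r <= ht y ->
  ht x + #|V|%:R <= M%:R -> ht y + #|V|%:R <= M%:R ->
  reach r x y (2 * #|V| + 2 * cost M)%:R.
Proof.
move=> cc rx ry xM yM; have [c H] := cc M.
have [g [xg xl gl]] := reach_outward e_sym e_irr x.
have [h [yh yl hl]] := reach_outward e_sym e_irr y.
pose n := minn (len g) (len h).
have gM : (len g <= M)%N by rewrite -(ler_nat R) (le_trans gl).
have hM : (len h <= M)%N by rewrite -(ler_nat R) (le_trans hl).
have gc := H n g (geq_minl _ _) gM; have hc := H n h (geq_minr _ _) hM.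
have rn : r <= n%:R.
  by rewrite /n /minn; case: ifP => _; [apply: le_trans rx xl|apply: le_trans ry yl].
have -> : (2 * #|V| + 2 * cost M)%:R = #|V|%:R + (cost M + cost M)%:R + #|V|%:R :> R.
  by rewrite -!natrD; congr (_%:R); lia.
apply: reach_trans (reach_sym (reach_weak ry (lexx _) yh)).
apply: reach_trans (reach_weak rx (lexx _) xg) _.
apply: (reach_weak rn (lexx _)).
exact: vreach_trans gc (vreach_sym hc).
Qed.

(** The cycle is coned off: paths from a point [x0] of the support to the points [x], weighted by
    the coefficients, have boundary [z] minus [deg z] times [x0]. *)
Lemma acyclic_of_cone cost : cone_cost R e cost -> acyclic_at_infinity0 e (1 : R).
Proof.
move=> cc r z r0 dz az.
(* The default occurs only for [z = 0], when the chain below is empty. *)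
pose x0 := head (cover_base R e) (dom z).
have x0z x : x \in dom z -> x0 \in dom z.
  by rewrite /x0; case: (dom z) => //= y s _; apply: mem_head.
have zr x : x \in dom z -> r <= ht x by move=> /az /avoidantE; apply.
have step x : exists f : continuousType I X, x \in dom z ->
    [/\ f one = x, f zero = x0 & forall t, avoidant r (f t)].
  case: (boolP (x \in dom z)) => [xz|nxz]; last by exists (cst x0).
  pose b := Num.max (ht x0) (ht x).
  have [] := @cone_reach cost x0 x r (floor_bound b) cc; rewrite ?zr ?(x0z x) //.
  - by apply: le_trans (floor_boundP b); rewrite lerD2r le_max lexx.
  - by apply: le_trans (floor_boundP b); rewrite lerD2r le_max lexx orbT.
  move=> f [L0 f0 fL fl fr].
  have [P [Pr _]] := reach_path e_sym e_irr (ex_intro _ f (And5 L0 f0 fL fl fr)).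
  by exists P => _; split; [apply: path_one|apply: path_zero|apply: Pr].
have [p pP] := boolp.choice step.
exists (\sum_(x <- dom z) << coeff x z *g p x >>).
  move=> f /dom_sum_subset /flatten_mapP[x xz].
  have nz : coeff x z != 0.
    by move: xz; rewrite mem_filter /= mem_dom.
  rewrite domU // inE => /eqP -> t; rewrite mul1r.
  by move: xz; rewrite mem_filter /= => /pP[_ _].
rewrite /chain_boundary fglift_sum.
rewrite (eq_big_seq (fun x => << coeff x z *g x >> - << coeff x z *g x0 >>)); last first.
  move=> x xz; rewrite liftU /simplex_boundary; have [-> -> _] := pP x xz.
  by rewrite scalerBr !freegZ.
by rewrite sumrB freeg_sumE freegU_sum -deg_coeff dz freegU0 subr0.
Qed.

Lemma Div0_exists_of_cone cost : cone_cost R e cost -> Div0_exists R e.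
Proof.
by move=> cc; exists 1; split; [rewrite ltr01 lexx|apply: acyclic_of_cone cc].
Qed.

Lemma rho_bar_gt0 : Div0_exists R e -> 0 < rho_bar R e.
Proof.
move=> [rho [/andP[r0 r1] ar]]; apply: (lt_le_trans r0); apply: ub_le_sup => //.
  by exists 1 => x [/andP[]].
by split=> //; rewrite r0.
Qed.

Lemma rho_bar_le1 : Div0_exists R e -> rho_bar R e <= 1.
Proof.
by move=> ne; apply: ge_sup => // x [/andP[]].
Qed.

Lemma div0_upper cost rho r : cone_cost R e cost -> 0 < rho <= 1 -> 0 < r ->
  (div0 e rho r <= (2 * #|V| + 2 * cost (floor_bound r))%:R%:E)%E.
Proof.
move=> cc /andP[rho0 rho1] r0; apply: ge_ereal_sup => _ [x [y [/sphereE hx /sphereE hy ->]]].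
apply: reach_avoidant_dist => //.
have rr : rho * r <= r by rewrite ler_piMl // ltW.
by apply: cone_reach; rewrite // ?hx ?hy // floor_boundP.
Qed.

End Acyclic.

(** * Lower bounds *)

Section Crossing.
Context (R : realType).
Local Notation I := (unit_itv R).
Variables (psi : I -> nat) (kap : nat).
Hypothesis psi_local : forall t : I, exists2 d : R, 0 < d &
  forall s : I, `|val t - val s| < d -> (psi s <= psi t + kap)%N /\ (psi t <= psi s + kap)%N.

Definition below (B : nat) : set R := [set val t | t in [set t : I | (psi t < B)%N]]%classic.

(* Since psi may jump by kap, its value at the last time below level B is only
   approximately B. *)
Lemma crossing B : (psi zero < B)%N -> (B <= psi one)%N -> exists t : I,
  [/\ val t = sup (below B), (psi t < B + kap)%N & (B <= psi t + kap)%N].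
Proof.
move=> B0 B1; have hs : has_sup (below B).
  split; first by exists (val (zero : I)), zero.
  by exists 1 => _ [t _ <-]; have /andP[] := unit_itvP t.
have s01 : 0 <= sup (below B) <= 1.
  apply/andP; split.
    by apply: ub_le_sup; [exact: (proj2 hs)|exists zero].
  by apply: ge_sup; [exact: (proj1 hs)|move=> _ [t _ <-]; have /andP[] := unit_itvP t].
pose t : I := SigSub (mem_unit_itv s01); exists t.
have tE : val t = sup (below B) by [].
have [d d0 dH] := psi_local t; split=> //.
  have [_ [s sB <-] ds] := sup_adherent d0 hs.
  have st : val s <= val t by rewrite tE; apply: ub_le_sup; [exact: (proj2 hs)|exists s].
  have [_ H] : (psi s <= psi t + kap)%N /\ (psi t <= psi s + kap)%N.
    apply: dH; rewrite ger0_norm ?subr_ge0 //; rewrite tE; lra.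
  by apply: leq_ltn_trans H _; rewrite ltn_add2r.
have [t1|t1] := eqVneq (val t) 1.
  suff -> : t = one by apply: leq_trans B1 (leq_addr _ _).
  exact: val_inj.
have tlt1 : val t < 1 by rewrite lt_neqAle t1; case/andP: (s01).
(* A time shortly after the supremum, hence not below level [B], and still in the interval. *)
pose s0 := Num.min 1 (val t + d / 2).
have s0t : val t < s0.
  by rewrite /s0 lt_min tlt1 ltrDl divr_gt0.
have s01' : 0 <= s0 <= 1.
  by rewrite {2}/s0 ge_min lexx andbT; apply: le_trans (ltW s0t); case/andP: (s01).
pose s : I := SigSub (mem_unit_itv s01').
have sd : s0 <= val t + d / 2 by rewrite /s0 ge_min lexx orbT.
have [H _] : (psi s <= psi t + kap)%N /\ (psi t <= psi s + kap)%N.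
  apply: dH; rewrite distrC ger0_norm ?subr_ge0 ?(ltW s0t) //=; move: sd d0 => /=; lra.
apply: leq_trans H; rewrite leqNgt; apply/negP => sB.
have : s0 <= val t by rewrite tE; apply: ub_le_sup; [exact: (proj2 hs)|exists s].
by rewrite leNgt s0t.
Qed.

Lemma sup_below_le B B' : (psi zero < B)%N -> (B <= B')%N -> sup (below B) <= sup (below B').
Proof.
move=> B0 BB; apply: ge_sup; first by exists (val (zero : I)), zero.
move=> _ [t tB <-]; apply: ub_le_sup; last by exists t => //; apply: leq_trans tB BB.
by exists 1 => _ [s _ <-]; have /andP[] := unit_itvP s.
Qed.

End Crossing.

(** * Lower bounds for the length of a path *)

Section PathBounds.
Context (R : realType) (V : finType) (e : rel V).
Hypotheses (e_sym : symmetric e) (e_irr : irreflexive e).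
Local Notation A := (raag e).
Local Notation X := (raag_cover R e).
Local Notation I := (unit_itv R).
Local Notation ht := (height 1%g).
Implicit Types (x y : X) (r rho : R) (g h : A).

Lemma continuous_local (f : continuousType I X) (t : I) (d : R) : 0 < d ->
  exists2 c : R, 0 < c & forall s : I, `|val t - val s| < c -> (cover_dist (f t) (f s) < d%:E)%E.
Proof.
move=> d0; have := @cts_fun _ _ f t; move=> /(_ (ball (f t) d) (nbhsx_ballx _ _ d0)) H.
by have /unit_itv_nbhsP[c c0 cH] : nbhs t (f @^-1` ball (f t) d)%classic := H; exists c.
Qed.

Lemma path_length_ge0 (f : I -> X) : (0 <= path_length f)%E.
Proof. by apply: ereal_sup_ubound; exists [::] => //; rewrite big_nil. Qed.

Lemma path_length_dist (f : I -> X) : (cover_dist (f zero) (f one) <= path_length f)%E.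
Proof.
apply: ereal_sup_ubound; exists [:: zero; one]; last by rewrite /= big_cons big_nil adde0.
by rewrite /= andbT ler01.
Qed.

Lemma path_length_steps (f : I -> X) (T : nat -> I) n (E : R) :
  {homo T : i j / (i <= j)%N >-> val i <= val j} ->
  (forall i, (i < n)%N -> (E%:E <= cover_dist (f (T i)) (f (T i.+1)))%E) ->
  ((E *+ n)%:E <= path_length f)%E.
Proof.
move=> mT H; set u := [seq T i | i <- iota 0 n.+1].
apply: (@le_trans _ _ (\sum_(p <- zip u (behead u)) cover_dist (f p.1) (f p.2))%E); last first.
  apply: ereal_sup_ubound; exists u => //=.
  suff : path (fun a b => val a <= val b) (T 0%N) [seq T i | i <- iota 1 n] by [].
  have S k m : path (fun a b : I => val a <= val b) (T k) [seq T i | i <- iota k.+1 m].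
    by elim: m k => //= m IH k; rewrite IH mT.
  exact: S.
rewrite {}/u; have {H} : forall i, (0 <= i < 0 + n)%N -> (E%:E <= cover_dist (f (T i)) (f (T i.+1)))%E.
  by move=> i; apply: H.
elim: n 0%N => [|n IH] k H; first by rewrite /= big_nil.
rewrite /= big_cons /= mulrS EFinD; apply: leeD; first by apply: H; rewrite leqnn addnS ltnS leq_addr.
by apply: IH => i /andP[ki ik]; apply: H; rewrite (ltnW ki) addnS -addSn.
Qed.

(** A sphere of non-integral radius contains no vertex. Its point is found on the edge from [g] to
    [g a], where the distance has slope 1 and [vert] is still [g]. *)
Lemma sphere_point g a (c : R) : len (g * raag_gen e a)%g = (len g).+1 -> 0 <= c < 1 ->
  exists2 x, vert x = g & ht x = (len g)%:R + c.
Proof.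
move=> L /andP[c0 c1]; pose t : {ffun V -> R} := [ffun b => if b == a then c else 0].
have ct : cube_coord (pred1 a) t.
  split=> b; rewrite ffunE; first by case: eqP; rewrite ?c0 ?(ltW c1) ?lexx ?ler01.
  by rewrite inE => /negbTE ->.
have E := chart_ptE g (clique1 e a) ct.
exists (chart_pt g t).
  rewrite /vert E /cube_chart /= big_pred0 ?mulg1 // => b; rewrite ffunE.
  by case: (b == a); rewrite ?(lt_eqF c1) // eq_sym oner_eq0.
rewrite (height_chart e_sym e_irr 1%g (clique1 e a) ct E) invg1 mul1g /height0; congr (_ + _).
rewrite (bigD1 a) //= big1 ?addr0 => [|b /negbTE ba]; rewrite ffunE ?ba ?mulr0 //.
have := len_slope R e_sym e_irr g a; rewrite L -natr1 => /addrI <-.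
by rewrite eqxx mul1r.
Qed.

Lemma sphere_power a r : 0 <= r -> exists2 x, ht x = r &
  vert x = (letter e (a, true) ^+ Num.truncn r)%g.
Proof.
move=> r0; pose k := Num.truncn r.
have kr : k%:R <= r by rewrite truncn_le.
have rk : r < k.+1%:R by apply: truncnS_gt.
have [||x xv xh] := @sphere_point (letter e (a, true) ^+ k)%g a (r - k%:R).
- by rewrite -letter_gen -expgSr !len_power.
- by rewrite subr_ge0 kr /= ltrBlDr addrC natr1.
by exists x => //; rewrite xh len_power // addrC subrK.
Qed.

(** Equal powers of two generators are at distance twice the exponent. Truncating the radius loses
    2, and passing to vertices loses twice [#|V|]. *)
Lemma div0_linear_lower rho r : (1 < #|V|)%N -> 0 < r ->
  ((r *+ 2 - 2 - #|V|%:R *+ 2)%:E <= div0 e rho r)%E.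
Proof.
move=> V1 r0; have /card_gt0P[a _] : (0 < #|V|)%N by apply: ltnW.
have [b ba] : exists b, b != a.
  have /card_gt0P[b] : (0 < #|predC1 a|)%N by rewrite cardC1 -ltnS prednK // ltnW.
  by rewrite inE => ba; exists b.
have [x xh xv] := sphere_power a (ltW r0); have [y yh yv] := sphere_power b (ltW r0).
apply: (@le_trans _ _ (avoidant_dist (rho * r) x y)); last first.
  by apply: ereal_sup_ubound; exists x, y; split=> //; apply/sphereE.
apply: le_ereal_inf_tmp => _ [P [_ ->]]; apply: le_trans (path_length_dist P).
rewrite path_zero path_one; apply: le_trans (dist_vert e_sym e_irr x y).
rewrite xv yv lee_fin; set k := Num.truncn r.
have -> : ((letter e (a, true) ^+ k)^-1 = letter e (a, false) ^+ k)%g.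
  by rewrite -expVgn (letter_linv e (a, true)).
rewrite len_powers //; last by rewrite eq_sym.
have rk : r < k.+1%:R by apply: truncnS_gt.
rewrite lerD2r natrD -natr1 in rk *; lra.
Qed.

Lemma vert_close x y : (cover_dist x y < 1%:E)%E ->
  (len ((vert x)^-1 * vert y)%g <= 2 * #|V| + 1)%N.
Proof.
move=> xy; have := le_lt_trans (dist_vert e_sym e_irr x y) xy.
rewrite lte_fin ltrBlDr => H; rewrite -ltnS -(ltr_nat R); apply: (lt_le_trans H).
by rewrite -natr1 natrD natrM mulr_natl; lra.
Qed.

Section Quadratic.
Variables (al : nat -> V) (m : nat).
Hypothesis al_step : forall i, (al i != al i.+1) && ~~ e (al i) (al i.+1).
Hypothesis al_cover : forall i c, exists2 j, (j < m)%N & al (i + j)%N = c.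

Local Notation kap := (2 * #|V| + 1)%N.
(** A crossing time fixes [progress] only up to [kap]; levels spaced by [2 * kap + m] thus leave the
    gap [m] that [progress_far] requires. *)
Local Notation level := (2 * kap + m)%N.

Lemma progress_close g h : (progress al h <= progress al g + len (g^-1 * h)%g)%N.
Proof. by rewrite -{1}(mulVKg g h); apply: progressM. Qed.

(** The crossing times of [n + 1] levels bound [n] legs. By [progress_far] each leg costs at least
    the length of its starting vertex minus the progress there; replacing points by vertices loses
    [#|V|] in the height and twice [#|V|] in the distance. *)
Lemma path_length_quadratic x y (P : {path I from x to y}) (D : R) n :
  progress al (vert x) = 0%N -> (n.+1 * level <= progress al (vert y))%N ->
  (forall t, avoidant D (P t)) ->
  (((D - (3 * #|V| + n.+1 * level + kap)%:R) *+ n)%:E <= path_length P)%E.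
Proof.
move=> x0 yn PD; pose psi (t : I) := progress al (vert (P t)).
have local (t : I) : exists2 d : R, 0 < d & forall s : I, `|val t - val s| < d ->
    (psi s <= psi t + kap)%N /\ (psi t <= psi s + kap)%N.
  have [c c0 cH] := continuous_local P t ltr01; exists c => // s /cH /vert_close H; split.
    by apply: leq_trans (progress_close (vert (P t)) _) _; rewrite leq_add2l.
  apply: leq_trans (progress_close (vert (P s)) _) _; rewrite leq_add2l.
  by rewrite -lenV // invgM invgK.
have psi0 : psi zero = 0%N by rewrite /psi path_zero.
have psi1 : (n.+1 * level <= psi one)%N by rewrite /psi path_one.
have lev0 : (0 < level)%N by rewrite addn_gt0 muln_gt0 addn1.
have step i : exists t : I, (i <= n)%N -> [/\ val t = sup (below psi (i.+1 * level)),
    (psi t < i.+1 * level + kap)%N & (i.+1 * level <= psi t + kap)%N].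
  case: (leqP i n) => [i_n|_]; last by exists zero.
  have [||t tP] := crossing local (B := (i.+1 * level)%N); last by exists t.
    by rewrite psi0 muln_gt0.
  by apply: leq_trans psi1; rewrite leq_mul2r ltnS i_n orbT.
have [T TP] := boolp.choice step.
(* Stopping at [n] makes the sequence of times monotone on all natural numbers. *)
pose T' i := T (minn i n).
apply: (@path_length_steps _ T').
  move=> i j ij; have [-> _ _] := TP _ (geq_minr i n); have [-> _ _] := TP _ (geq_minr j n).
  by apply: sup_below_le; rewrite ?psi0 ?muln_gt0 // leq_mul2r ltnS leq_min geq_minr geq_min ij orbT.
move=> i i_n; rewrite /T' (minn_idPl (ltnW i_n)) (minn_idPl i_n).
have [_ p1 p2] := TP i (ltnW i_n); have [_ q1 q2] := TP i.+1 i_n.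
apply: le_trans (dist_vert e_sym e_irr _ _); rewrite lee_fin.
set p := P (T i) in p1 p2 *; set q := P (T i.+1) in q1 q2 *.
have far : (progress al (vert p) + m <= progress al (vert q))%N.
  by rewrite -/(psi (T i)) -/(psi (T i.+1)) in q2 p1 *; lia.
have := progress_far e_sym e_irr al_step al_cover far.
have := height_vert 1%g p; rewrite invg1 mul1g.
have /(avoidantE e_sym e_irr) : avoidant D p by apply: PD.
set l := len (vert p); set d := len (_ * _)%g => Dp hv.
rewrite -/p -/(psi (T i)) in p1; move: p1; rewrite -/p /psi => p1 dl.
have {}dl : (l <= d + (n.+1 * level + kap))%N.
  apply: leq_trans dl _; rewrite leq_add2l; apply: leq_trans (ltnW p1) _.
  by rewrite leq_add2r leq_mul2r ltnS (ltnW i_n) orbT.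
move: dl; rewrite -(ler_nat R) natrD => dl.
move: hv; rewrite ler_norml => /andP[_ hv].
rewrite -addnA natrD natrM mulr_natl -[3%N]/(2 + 1)%N mulrnDr mulr1n.
lra.
Qed.

End Quadratic.

End PathBounds.

(** * Disconnected graphs *)

Section Disconnected.
Context (R : realType) (V : finType) (e : rel V).
Hypotheses (e_sym : symmetric e) (e_irr : irreflexive e).
Local Notation A := (raag e).
Local Notation X := (raag_cover R e).
Local Notation I := (unit_itv R).
Local Notation ht := (height 1%g).
Implicit Types (x y : X) (r rho : R) (g h : A).
Variable a : V.

Local Notation conn := (connect e a).

Lemma conn_edge b c : e b c -> conn b = conn c.
Proof.
move=> bc; apply/idP/idP => H; apply: connect_trans H _; apply: connect1 => //.
by rewrite e_sym.
Qed.

(** Distinct initial letters are adjacent, so they all lie in one component and any of them decides.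
    The value at [g = 1] is false. *)
Definition side_letter g : bool := [exists s : V * bool, ini g s && conn s.1].

Lemma side_letterE g s : ini g s -> side_letter g = conn s.1.
Proof.
move=> gs; apply/existsP/idP => [[t /andP[gt ct]]|cs]; last by exists s; rewrite gs.
have [E|/eqP nst] := eqVneq s t; first by rewrite E.
by rewrite (conn_edge (ini_adj e_sym gs gt nst)).
Qed.

Lemma side_letterM g s : g <> 1%g -> (g * letter e s)%g <> 1%g ->
  side_letter (g * letter e s)%g = side_letter g.
Proof.
have up h t : h <> 1%g -> len (h * letter e t)%g = (len h).+1 ->
    side_letter (h * letter e t)%g = side_letter h.
  move=> /(ini_exists e_sym e_irr)[u hu] L; rewrite (side_letterE hu).
  by apply/side_letterE/ini_prefix => //; rewrite L len_letter // addn1.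
move=> g1 gs1; have := len_Mletter e_sym e_irr g s; case: ifP => [i L|_]; last exact: up.
have E : (g * letter e s * letter e (linv s))%g = g by rewrite letter_linv mulgK.
have U := up _ (linv s) gs1; rewrite E in U; rewrite U // L prednK //.
by rewrite -lenV // (ini_len e_sym e_irr i).
Qed.

Section Cube.
Variables (S : {pred V}) (c0 : V).
Hypotheses (cS : clique e S) (Sc0 : c0 \in S).

Lemma conn_clique b : b \in S -> conn b = conn c0.
Proof.
move=> bS; have [->//|bc] := eqVneq b c0; apply: conn_edge.
by move/cliqueP: cS; apply.
Qed.

(** The cut vertex itself has no side; there a direction [c0] of the cube decides, which makes the
    value constant on the vertices of the cube. *)
Definition cube_side g : bool := if `[< g = 1%g >] then conn c0 else side_letter g.

Lemma cube_side_gen g b : b \in S -> cube_side (g * raag_gen e b)%g = cube_side g.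
Proof.
move=> bS; rewrite /cube_side -letter_gen.
case: asboolP => gb1; case: asboolP => g1 //.
- have gE : g = letter e (b, false).
    by rewrite (letter_linv e (b, true)) -(mulg1_eq gb1) invgK.
  rewrite (@side_letterE g (b, false)) ?conn_clique //.
  by rewrite gE ini_reduced //= ?initial_head // initial_nil.
- rewrite g1 mul1g (@side_letterE _ (b, true)) ?conn_clique //.
  by rewrite ini_reduced //= ?initial_head // initial_nil.
- by rewrite side_letterM.
Qed.

Lemma cube_side_prod g (r : seq V) (p : pred V) : (forall b, p b -> b \in S) ->
  cube_side (g * \big[*%g/1%g]_(b <- r | p b) raag_gen e b)%g = cube_side g.
Proof.
move=> pS; elim: r g => [|b r IH] g; first by rewrite big_nil mulg1.
rewrite big_cons; case: ifP => pb //.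
by rewrite mulgA IH cube_side_gen // pS.
Qed.

End Cube.

(* Whether paths from the cut point e to x start in the component of a. *)
Definition side x : bool :=
  if `[< vert x = 1%g >] then [exists c, ((cover_val x).2 c != 0) && conn c]
  else side_letter (vert x).

Lemma side_chart (S : {pred V}) c0 g t x : clique e S -> c0 \in S -> cube_coord S t ->
  cover_val x = cube_chart g t -> x <> cover_base R e -> side x = cube_side c0 g.
Proof.
move=> cS Sc0 St xE xb.
have tS b : t b == 1 -> b \in S.
  by move=> /eqP tb; apply: (cube_coord_mem St); rewrite tb oner_eq0.
rewrite -(cube_side_prod cS Sc0 g (index_enum V) tS).
have vE : vert x = (g * \big[*%g/1%g]_(b | t b == 1%R) raag_gen e b)%g by rewrite /vert xE.
rewrite /side /cube_side vE; case: asboolP => // v1.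
have tx b : (cover_val x).2 b != 0 -> b \in S.
  rewrite xE /= ffunE; case: (t b =P 1) => [_|_]; first by rewrite eqxx.
  exact: cube_coord_mem St.
have [b xb0] : exists b, (cover_val x).2 b != 0.
  apply/existsP; apply: contraT => /existsPn H; case: xb; apply: val_inj => /=.
  rewrite [LHS](surjective_pairing _) -/(vert x) vE v1; congr pair.
  by apply/ffunP => b; rewrite ffunE; apply/eqP; have := H b; rewrite negbK.
apply/existsP/idP => [[c /andP[/tx cS' cc]]|cc].
  by rewrite -(conn_clique cS Sc0 cS').
by exists b; rewrite xb0 (conn_clique cS Sc0 (tx _ xb0)).
Qed.

Lemma height_base_point : ht (cover_base R e) = 0.
Proof. by rewrite -vertex1 height_vertex mulg1 invg1 len1. Qed.

(** Each step lowers the height by at most its cost, so a string cheaper than [ht x] never meets the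
    base point, and within one cube the side is constant away from that point. *)
Lemma side_string x y c : cube_string x y c -> c < ht x -> side x = side y.
Proof.
elim=> {x y c}[//|x y z g S s t c cS Ss St xE yE yz IH] lt.
have c0 := cube_string_ge0 yz.
have hy : c < ht y.
  have := height_string e_sym e_irr 1%g (StringCons cS Ss St xE yE (StringNil y)).
  by rewrite addr0 ler_norml => /andP[_]; lra.
have d0 : 0 <= l1_dist s t by apply: sumr_ge0.
have nb w : 0 < ht w -> w <> cover_base R e.
  by move=> + E; rewrite E height_base_point ltxx.
rewrite -(IH hy).
have [/existsP[b bS]|/existsPn S0] := boolP [exists b, b \in S].
  rewrite (side_chart cS bS Ss xE) ?(side_chart cS bS St yE) //; apply: nb; lra.
have st : s = t.
  by apply/ffunP => b; case: Ss => _ ->; rewrite ?S0 //; case: St => _ ->; rewrite ?S0.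
by congr side; apply: val_inj; rewrite /= xE yE st.
Qed.

(** By [side_string] the side is locally constant along an avoidant path; [crossing] with jump 0
    supplies the connectedness of the interval. *)
Lemma side_path (f : continuousType I X) rho : 0 < rho -> (forall t, avoidant rho (f t)) ->
  side (f zero) = side (f one).
Proof.
move=> rho0 fr.
have local (t : I) : exists2 d : R, 0 < d & forall s : I, `|val t - val s| < d ->
    side (f t) = side (f s).
  have [c c0 cH] := continuous_local f t rho0; exists c => // s /cH /cover_dist_ltP[l fl lr].
  apply: (side_string fl); apply: (lt_le_trans lr).
  exact/(avoidantE e_sym e_irr).
(* The exclusive or with [b] treats both directions of change at once. *)
have crossF (b : bool) : (b (+) side (f zero)) = false -> (b (+) side (f one)) = true -> False.
  move=> b0 b1; pose psi (t : I) := nat_of_bool (b (+) side (f t)).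
  have loc (t : I) : exists2 d : R, 0 < d & forall s : I, `|val t - val s| < d ->
      (psi s <= psi t + 0)%N /\ (psi t <= psi s + 0)%N.
    by have [d d0 dH] := local t; exists d => // s /dH; rewrite /psi => ->; rewrite addn0.
  have [||t [_ t1 t2]] := crossing loc (B := 1%N); rewrite /psi ?b0 ?b1 //.
  by move: t1 t2; rewrite !addn0 => /leq_trans H /H; rewrite ltnn.
case E0 : (side (f zero)); case E1 : (side (f one)) => //; exfalso.
  by apply: (crossF true); rewrite ?E0 ?E1.
by apply: (crossF false); rewrite ?E0 ?E1.
Qed.

Lemma side_boundary (c : {freeg (continuousType I X) / int}) rho : 0 < rho ->
  avoidant_chain1 rho c ->
  fglift (fun x => (side x)%:R : int^o) (chain_boundary c) = 0.
Proof.
move=> rho0 cr; rewrite -(freeg_sumE c) /chain_boundary !fglift_sum big_seq big1 // => f fc.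
rewrite liftU /simplex_boundary scalerBr !freegZ lift_is_additive !liftU.
by rewrite (side_path rho0 (cr f fc)) subrr.
Qed.

(** As a cochain, [side] vanishes on boundaries of avoidant chains, but it takes the value 1 on the
    cycle formed by the vertices [a] and [b] at radius 1. *)
Lemma not_acyclic b rho : ~~ conn b -> 0 < rho -> ~ acyclic_at_infinity0 e rho.
Proof.
move=> nb rho0 /(_ 1 (<< vertex R (raag_gen e a) >> - << vertex R (raag_gen e b) >>) ltr01).
have sv d : side (vertex R (raag_gen e d)) = conn d.
  rewrite /side vert_vertex; case: asboolP => d1; first by have := raag_gen_neq1 e_sym e_irr d1.
  rewrite (@side_letterE _ (d, true)) // -letter_gen ini_reduced //= ?initial_head //.
  by rewrite initial_nil.
rewrite /deg lift_is_additive !liftU subrr => /(_ erefl)[].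
  move=> x /domB; rewrite mem_cat !domU1 !inE => xE; apply/avoidantE => //.
  by case/orP: xE => /eqP ->; rewrite height_vertex // invg1 mul1g -letter_gen len_letter.
move=> c; rewrite mulr1 => cr bc; have := side_boundary rho0 cr; rewrite bc.
by rewrite lift_is_additive !liftU !sv connect0 (negbTE nb).
Qed.

End Disconnected.

(** * Comparison of families *)

Section Comparison.
Context (R : realType) (V : finType) (e : rel V).
Hypotheses (e_sym : symmetric e) (e_irr : irreflexive e) (V_gt1 : (1 < #|V|)%N).
Implicit Types (r rho : R).

Lemma div0_quadratic_lower rho : (forall a b, connect (opposed e) a b) -> 0 < rho <= 1 ->
  exists c C : R, 0 < c /\ forall r, 0 < r -> ((c * r ^+ 2 - C)%:E <= div0 e rho r)%E.
Proof.
move=> opp /andP[rho0 rho1].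
have [al [m [al_step al_period al_cover]]] := exists_axis V_gt1 opp.
pose kap := (2 * #|V| + 1)%N; pose level := (2 * kap + m)%N.
have lev1 : 1 <= level%:R :> R by rewrite ler1n /level /kap addn_gt0 muln_gt0 addn1.
pose K : R := (3 * #|V| + kap)%:R; pose T : R := 8 * level%:R + 4 * K + 4.
have K0 : 0 <= K by apply: ler0n.
(* With [D = rho * r] and [q = D / (2 * level)] there are at least [q / 2] legs of cost at least
   [D / 4], which gives [D ^+ 2 / (16 * level)]. Both estimates hold once [D >= T]; for smaller [D]
   the bound is negative. *)
exists (rho ^+ 2 / (16 * level%:R)), (T ^+ 2 / (16 * level%:R)).
have lev16 : 0 < 16 * level%:R :> R by lra.
split=> [|r r0]; first by rewrite divr_gt0 // exprn_gt0.
(* The vertex of [x] is a power of [al 1], which differs from [al 0], so its progress is 0; the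
   vertex of [y] lies on the axis. *)
have [x xh xv] := sphere_power e_sym e_irr (al 1%N) (ltW r0).
pose k := Num.truncn r.
have kr : k%:R <= r by rewrite truncn_le ltW.
have rk : r < k.+1%:R by apply: truncnS_gt.
have [||y yv yh] := @sphere_point R _ _ e_sym e_irr (axis e al 0 k) (al k) (r - k%:R).
- have -> : (axis e al 0 k * raag_gen e (al k) = axis e al 0 k.+1)%g.
    by rewrite -addn1 axisD add0n.
  by rewrite !len_axis.
- by rewrite subr_ge0 kr /= ltrBlDr addrC natr1.
rewrite len_axis // addrC subrK in yh.
apply: (@le_trans _ _ (avoidant_dist (rho * r) x y)); last first.
  by apply: ereal_sup_ubound; exists x, y; split=> //; apply/sphereE.
apply: le_ereal_inf_tmp => _ [P [Pr ->]].
set D := rho * r in Pr.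
have -> : rho ^+ 2 / (16 * level%:R) * r ^+ 2 - T ^+ 2 / (16 * level%:R) =
    (D ^+ 2 - T ^+ 2) / (16 * level%:R) by rewrite /D mulrAC -mulrBl exprMn.
have D0 : 0 < D by rewrite mulr_gt0.
have [DT|TD] := ltP D T.
  apply: le_trans (path_length_ge0 P); rewrite lee_fin pmulr_lle0 ?invr_gt0 // subr_le0.
  by apply: lerXn2r; rewrite ?nnegrE; lra.
pose q := D / (2 * level%:R); pose N := Num.truncn q.
have lev2 : 0 < 2 * level%:R :> R by lra.
have qlev : q * (2 * level%:R) = D by rewrite divfK // lt0r_neq0.
have q4 : 4 <= q by rewrite ler_pdivlMr //; rewrite /T in TD; lra.
have Nq : N%:R <= q by rewrite truncn_le; lra.
have qN : q < N.+1%:R by apply: truncnS_gt.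
have N1 : (0 < N)%N by rewrite -(ltr_nat R) -natr1 in qN *; lra.
have Dr : D <= r by rewrite ler_piMl // ltW.
have Nlev : N%:R * level%:R <= D / 2 by nra.
have Nk : (N * level <= k)%N.
  rewrite -ltnS -(ltr_nat R) natrM; rewrite /T in TD; rewrite -natr1 in rk *; lra.
have prx : progress al (vert x) = 0%N.
  rewrite xv; apply/eqP; rewrite -leqn0 leqNgt; apply/negP => p0.
  have : pre al 0 1 (letter e (al 1%N, true) ^+ Num.truncn r)%g.
    by apply: pre_le p0 _ => //; apply: pre_progress.
  rewrite preS // => /andP[+ _].
  rewrite -cls_nseq => /(ini_mem e_sym e_irr); rewrite mem_nseq xpair_eqE => /andP[_ /andP[/eqP E _]].
  by have := al_step 0%N; rewrite E eqxx.
have pry : (N.-1.+1 * level <= progress al (vert y))%N.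
  by rewrite prednK // yv; apply: leq_trans Nk _; apply: progress_axis.
have := path_length_quadratic e_sym e_irr al_step al_cover prx pry Pr.
apply: le_trans; rewrite lee_fin prednK // -[leRHS]mulr_natr -/kap -/level.
rewrite addnAC natrD -/K natrM ler_pdivrMr //.
have -> : (N.-1)%:R = N%:R - 1 :> R by rewrite -[in RHS](prednK N1) -natr1 addrK.
rewrite -natr1 in qN.
have E1 : D / 4 <= D - (K + N%:R * level%:R) by rewrite /T in TD; lra.
have E2 : q / 2 <= N%:R - 1 by lra.
have E3 : D / 4 * (q / 2) <= (D - (K + N%:R * level%:R)) * (N%:R - 1).
  by apply: ler_pM => //; lra.
apply: (@le_trans _ _ (D ^+ 2)); first by rewrite lerBlDr lerDl sqr_ge0.
have -> : D ^+ 2 = D / 4 * (q / 2) * (16 * level%:R).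
  by rewrite expr2 -{2}qlev; field.
by rewrite ler_pM2r.
Qed.

Lemma family_upper (h : R -> R) : Div0_exists R e ->
  (exists A C : R, 1 < A /\ forall rho r, 0 < rho <= 1 -> 0 < r ->
    (div0 e rho r <= (A * h (A * r + A) + C)%:E)%E) ->
  family_le (Div0 R e) (constant_family h).
Proof.
move=> ex [A [C [A1 H]]]; exists (rho_bar R e), 2; split; first exact: rho_bar_gt0.
  by rewrite ltr1n.
move=> rho /andP[r0 r1]; split=> //; first by rewrite /= r0.
exists A, C; split=> // x x0; rewrite /= -EFinM -EFinD.
by apply: H => //; rewrite r0 (le_trans r1) // rho_bar_le1.
Qed.

Lemma family_lower (h : R -> R) : Div0_exists R e ->
  (forall rho, 0 < rho <= 1 -> exists A C D : R, 1 < A /\ forall r, 0 < r ->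
    ((C * h (A * r + A) - D)%:E <= div0 e rho (A * r + A))%E /\
    h r <= A * (C * h (A * r + A))) ->
  family_le (constant_family h) (Div0 R e).
Proof.
move=> ex H; have b0 := rho_bar_gt0 ex; have b1 := rho_bar_le1 ex.
(* Halving [rho_bar] keeps the parameter [2 * rho] in the domain of [Div0]. *)
exists (rho_bar R e / 2), 2; split; [by rewrite divr_gt0|by rewrite ltr1n|].
move=> rho /andP[r0 r1].
have L : 0 < 2 * rho <= rho_bar R e by apply/andP; split; lra.
split=> //.
have [|A [C [D [A1 AC]]]] := H (2 * rho).
  by case/andP: L => -> /= L1; apply: le_trans L1 b1.
exists A, (A * D); split=> // x x0; have [le1 le2] := AC x x0.
apply: (@le_trans _ _ (A%:E * (C * h (A * x + A) - D)%:E + (A * D)%:E)%E).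
  by rewrite -EFinM -EFinD lee_fin mulrBr subrK.
by rewrite leeD2r // lee_pmul2l // lte_fin; lra.
Qed.

Lemma linear_asymp (P : pred V) a b : P a -> ~~ P b ->
  (forall c d, P c -> ~~ P d -> e c d) -> Div0_exists R e ->
  family_asymp (Div0 R e) (constant_family (fun r : R => r)).
Proof.
move=> Pa Pb Pj ex; have cc := cone_cost_join R e_sym e_irr Pa Pb Pj; split.
  apply: family_upper => //; set v : R := #|V|%:R; have v0 : 0 <= v by apply: ler0n.
  (* The cost is [2 * v + 16 * M] with [M <= r + v + 1]. *)
  exists 16, (18 * v + 16); split; first by rewrite ltr1n.
  move=> rho r rho1 r0; apply: le_trans (div0_upper e_sym e_irr cc rho1 r0) _.
  rewrite lee_fin natrD !natrM -/v; have := floor_bound_le V (ltW r0); rewrite -/v; lra.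
apply: family_lower => // rho _; set v : R := #|V|%:R.
exists 2, 2, (2 + v *+ 2); split; first by rewrite ltr1n.
move=> r r0; split; last by lra.
have r20 : 0 < 2 * r + 2 by lra.
apply: le_trans (div0_linear_lower e_sym e_irr rho V_gt1 r20).
by rewrite lee_fin -/v !mulr2n; lra.
Qed.

Lemma quadratic_upper : (forall a b, connect e a b) -> Div0_exists R e ->
  family_le (Div0 R e) (constant_family (fun r : R => r ^+ 2)).
Proof.
move=> conn ex; have cc := cone_cost_connected R e_sym e_irr conn V_gt1.
apply: family_upper => //; set v : R := #|V|%:R; have v0 : 0 <= v by apply: ler0n.
pose w := v + 2; have w2 : 2 <= w by rewrite /w; lra.
have w3 : 8 <= w ^+ 3.
  have -> : 8 = 2 ^+ 3 :> R by rewrite -natrX.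
  by rewrite lerXn2r // nnegrE; lra.
(* As [M + 1 <= w * (r + 1)], the cost is at most [40 * w ^+ 3 * (r + 1) ^+ 2 + 2 * v]; the factor
   exceeds 1, so it may also be inserted under the square. *)
exists (40 * w ^+ 3), (2 * v); split; first by lra.
move=> rho r rho1 r0; apply: le_trans (div0_upper e_sym e_irr cc rho1 r0) _.
rewrite lee_fin natrD !natrM natrD -/v -/w; set M := floor_bound V r.
have M1 : M.+1%:R <= w * (r + 1).
  have := floor_bound_le V (ltW r0); rewrite -/M -natr1 -/v /w; nra.
have M0 : 0 <= M.+1%:R :> R by apply: ler0n.
have M2 : M.+1%:R * M.+1%:R <= (w * (r + 1)) ^+ 2 by rewrite expr2; apply: ler_pM.
have A1 : 1 <= 40 * w ^+ 3 by lra.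
rewrite addrC lerD2r.
apply: (@le_trans _ _ (40 * w ^+ 3 * (r + 1) ^+ 2)).
  have -> : 40 * w ^+ 3 * (r + 1) ^+ 2 = 2 * (20 * w * (w * (r + 1)) ^+ 2) by ring.
  by rewrite ler_pM2l // ler_pM2l //; lra.
rewrite ler_pM2l; last by lra.
rewrite lerXn2r ?nnegrE //; nra.
Qed.

Lemma quadratic_lower : (forall a b, connect (opposed e) a b) -> Div0_exists R e ->
  family_le (constant_family (fun r : R => r ^+ 2)) (Div0 R e).
Proof.
move=> opp ex; apply: family_lower => // rho rho1.
have [c [C [c0 H]]] := div0_quadratic_lower opp rho1.
(* This makes [A * c >= 1], so the factor [A] outweighs a small [c]. *)
pose A := 2 + c^-1; have ci : 0 < c^-1 by rewrite invr_gt0.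
have A1 : 1 < A by rewrite /A; lra.
exists A, c, C; split=> // r r0; split; first by apply: H; nra.
have Ac : 1 <= A * c by rewrite /A mulrDl mulVf ?lt0r_neq0 //; nra.
rewrite mulrA; apply: (@le_trans _ _ ((A * r + A) ^+ 2)).
  by rewrite lerXn2r ?nnegrE; nra.
by rewrite ler_peMl // sqr_ge0.
Qed.

Lemma quadratic_not_linear : (forall a b, connect (opposed e) a b) -> Div0_exists R e ->
  ~ family_le (Div0 R e) (constant_family (fun r : R => r)).
Proof.
move=> opp ex [rho0 [L [rho00 L1 H]]]; have b0 := rho_bar_gt0 ex; have b1 := rho_bar_le1 ex.
pose rho := Num.min rho0 (rho_bar R e).
have rp : 0 < rho by rewrite lt_min rho00.
have [|_ _ [A [C [A1 up]]]] := H rho; first by rewrite rp ge_min lexx.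
have [|c [C' [c0 low]]] := @div0_quadratic_lower rho opp.
  by rewrite rp (le_trans _ b1) // ge_min lexx orbT.
(* For [r >= 1] with [c * r >= A * A + K + 1], the quadratic lower bound exceeds the linear upper
   bound [A * (A * r + A) + C]. *)
pose K := A * A + `|C| + `|C'|.
pose r := (A * A + K + 1) / c + 1.
have K0 : 0 <= K by rewrite !addr_ge0 // mulr_ge0 //; lra.
have AA : 0 < A * A by rewrite mulr_gt0; lra.
have r1 : 1 <= r by rewrite lerDr divr_ge0 //; lra.
have := le_trans (low r (lt_le_trans ltr01 r1)) (up r (lt_le_trans ltr01 r1)).
rewrite /= -EFinM -EFinD lee_fin => ineq.
have cr : A * A + K + 1 <= c * r.
  by rewrite /r mulrDr mulrCA divff ?lt0r_neq0 //; lra.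
have crr : (A * A + K + 1) * r <= c * r ^+ 2 by rewrite expr2 mulrA ler_pM2r //; lra.
have := ler_norm C; have := ler_norm C'; rewrite /K in K0 crr cr *; nra.
Qed.

End Comparison.

(* V_gt1 excludes the empty graph and the single vertex: there A is trivial or Z,
   and the claim fails (Z is two-ended although its graph is connected). *)
Theorem theorem7p1 (R : realType) (V : finType) (e : rel V)
    (e_sym : symmetric e) (e_irr : irreflexive e) (V_gt1 : (1 < #|V|)%N) :
  (Div0_exists R e <-> forall a b : V, connect e a b) /\
  (Div0_exists R e ->
     (family_asymp (Div0 R e) (constant_family (fun r : R => r)) <->
        nontrivial_direct_product (raag e)) /\
     (~ nontrivial_direct_product (raag e) ->
        family_asymp (Div0 R e) (constant_family (fun r : R => r ^+ 2)))).
Proof.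
have exE : Div0_exists R e <-> forall a b : V, connect e a b.
  split=> [[rho [/andP[r0 _] acyc]] a b|conn].
    by apply/negPn/negP => nab; apply: (not_acyclic e_sym e_irr nab r0 acyc).
  exact: Div0_exists_of_cone (cone_cost_connected R e_sym e_irr conn V_gt1).
split=> // ex; have conn := proj1 exE ex; split.
  split=> [[up _]|ndp].
    have [//|nndp] := boolp.EM (nontrivial_direct_product (raag e)).
    have opp := not_product_opposed e_sym e_irr nndp.
    by have := quadratic_not_linear e_sym e_irr V_gt1 opp ex up.
  have [P [[a Pa] [b Pb] Pj]] := product_join e_sym e_irr V_gt1 ndp.
  exact: linear_asymp Pa Pb Pj ex.
move=> nndp; have opp := not_product_opposed e_sym e_irr nndp; split.
  exact: quadratic_upper.
exact: quadratic_lower.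
Qed.
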